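(* Let $\mathcal{X}$ be a finite set, let $\mathcal{C}\subseteq\{\pm1\}^{\mathcal{X}}$ be a concept class, and let $W\in\{\pm1\}^{\mathcal{C}\times\mathcal{X}}$ be its concept matrix. Let $\varepsilon>0$ and $\alpha,\beta\in(0,1/2]$. (Upper bound.) There are non-interactive $\varepsilon$-LDP protocols that $(2\alpha,\beta)$-learn $\mathcal{C}$ agnostically, and non-interactive $\varepsilon$-LDP protocols that $(2\alpha,\beta)$-refute $\mathcal{C}$ agnostically, each using $$n=O\!\left(\frac{\gamma_2(W,\alpha)^2\log(|\mathcal{C}|/\beta)}{\varepsilon^2\alpha^2}\right)$$ samples. (Lower bound.) Fix any constant $c_0>0$. There is $\alpha'=\Omega\!\left(\frac{\alpha}{\log(1/\alpha)}\right)$ such that for every $\beta\le \frac12-c_0$, any non-interactive $\varepsilon$-LDP protocol that $(\alpha',\beta)$-learns $\mathcal{C}$ agnostically, and any non-interactive $\varepsilon$-LDP protocol that $(\alpha',\beta)$-refutes $\mathcal{C}$ agnostically, must use at least $$n=\Omega\!\left(\frac{(\gamma_2(W,\alpha)-1)^2}{\varepsilon^2\alpha^2}\right)$$ samples (the implied constants depending only on $c_0$).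
   Context: For a distribution $\mathcal{D}$ on $\mathcal{X}\times\{\pm1\}$ and $h:\mathcal{X}\to\{\pm1\}$, the loss is $L_{\mathcal{D}}(h)=\Pr_{(x,y)\sim\mathcal{D}}[h(x)\ne y]$. The concept matrix of $\mathcal{C}$ is $W\in\{\pm1\}^{\mathcal{C}\times\mathcal{X}}$ with entries $w_{c,x}=c(x)$. Norms: for a matrix $M$, $\|M\|_{1\to2}$ is the maximum Euclidean norm of a column, $\|M\|_{2\to\infty}$ the maximum Euclidean norm of a row, $\|M\|_{1\to\infty}$ the maximum absolute entry. The factorization norm is $\gamma_2(M)=\min\{\|R\|_{2\to\infty}\|A\|_{1\to2}: RA=M\}$, and the approximate factorization norm is $\gamma_2(M,\alpha)=\min\{\gamma_2(\widetilde M):\|\widetilde M-M\|_{1\to\infty}\le\alpha\}$. Non-interactive $\varepsilon$-LDP protocol on $n$ samples: data points $z_1,\dots,z_n\in\mathcal{Z}=\mathcal{X}\times\{\pm1\}$ are drawn i.i.d. from an unknown distribution $\mathcal{D}$; each $z_i$ is processed by a randomized map $R_i:\mathcal{Z}\to\mathcal{O}$ (a local randomizer) satisfying $\Pr[R_i(z)\in S]\le e^{\varepsilon}\Pr[R_i(z')\in S]$ for all $z,z'\in\mathcal{Z}$ and all events $S$; the output is a (possibly randomized) function of the transcript $(R_1(z_1),\dots,R_n(z_n))$. A protocol $(\alpha,\beta)$-learns $\mathcal{C}$ agnostically if for every distribution $\mathcal{D}$ on $\mathcal{X}\times\{\pm1\}$ it outputs $h:\mathcal{X}\to\{\pm1\}$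 with $L_{\mathcal{D}}(h)\le\min_{c\in\mathcal{C}}L_{\mathcal{D}}(c)+\alpha$ with probability at least $1-\beta$ (over samples and internal randomness). A protocol $(\alpha,\beta)$-refutes $\mathcal{C}$ agnostically if, with probability at least $1-\beta$, it correctly distinguishes (outputs $1$ in case (i), $-1$ in case (ii)) between: (i) $\min_{c\in\mathcal{C}}L_{\mathcal{D}}(c)\le\frac12-\alpha$, and (ii) $L_{\mathcal{D}}(h)=\frac12$ for all $h\in\{\pm1\}^{\mathcal{X}}$.
   Formalization: Proved for 0 < ε ≤ 1 (both bounds fail for large ε with absolute constants), and with (γ_2(W,α) − 1)² read as max(0, γ_2(W,α) − 1)² in the lower bound (a one-concept class has γ_2 < 1 and needs no samples to learn). *)

(* Defs.v *)
From HB Require Import structures.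
From mathcomp Require Import all_boot all_order all_algebra.
From mathcomp Require Import all_classical all_reals all_analysis.
From mathcomp Require Import Rstruct Rstruct_topology.

Set Implicit Arguments.
Unset Strict Implicit.
Unset Printing Implicit Defensive.

Import Order.TTheory GRing.Theory Num.Theory.
Local Open Scope ring_scope.
Local Open Scope classical_set_scope.

Section LDPDefs.
Context {R : realType}.

Definition pm (b : bool) : R := if b then 1 else -1.

(** ||L||_{2->oo} * ||A||_{1->2} for a factorization M = L A with inner dim k *)
Definition fact_cost (I J : finType) (k : nat)
    (L : I -> 'I_k -> R) (A : 'I_k -> J -> R) : R :=
  (\big[Num.max/0]_(i : I) Num.sqrt (\sum_(l < k) L i l ^+ 2)) *
  (\big[Num.max/0]_(j : J) Num.sqrt (\sum_(l < k) A l j ^+ 2)).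

Definition gamma2 (I J : finType) (M : I -> J -> R) : R :=
  inf [set r : R | exists (k : nat) (L : I -> 'I_k -> R) (A : 'I_k -> J -> R),
         (forall i j, \sum_(l < k) L i l * A l j = M i j) /\ r = fact_cost L A].

Definition gamma2_approx (I J : finType) (M : I -> J -> R) (alpha : R) : R :=
  inf [set r : R | exists Mt : I -> J -> R,
         (forall i j, `|Mt i j - M i j| <= alpha) /\ r = gamma2 Mt].

Definition concept_matrix (X : finType) (C : {set {ffun X -> bool}})
    : {c : {ffun X -> bool} | c \in C} -> X -> R :=
  fun c x => pm (sval c x).

Definition is_dist (T : finType) (D : T -> R) : Prop :=
  (forall t, 0 <= D t) /\ \sum_(t : T) D t = 1.

Definition loss (X : finType) (D : X * bool -> R) (h : X -> bool) : R :=
  \sum_(z : X * bool | h z.1 != z.2) D z.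

Section Protocol.
Context {d : measure_display} (O : measurableType d).

(** iterated integral  int[m1]_{o1} ... int[mk]_{ok} f [o1; ...; ok]
    (i.e. the integral of f against the product measure m1 x ... x mk) *)
Fixpoint iint (ms : seq (probability O R)) (f : seq O -> \bar R) : \bar R :=
  match ms with
  | [::] => f [::]
  | m :: ms' => (\int[m]_o iint ms' (fun os => f (o :: os)))%E
  end.

Definition eps_LDP (eps : R) (Z : Type) (Q : Z -> probability O R) : Prop :=
  forall (z z' : Z) (S : set O), measurable S ->
    (Q z S <= (expR eps)%:E * Q z' S)%E.

Definition is_decoder (H : finType) (n : nat) (Dec : seq O -> H -> R) : Prop :=
  (forall os h, 0 <= Dec os h) /\ (forall os, \sum_(h : H) Dec os h = 1) /\
  (forall h, measurable_fun [set: n.-tuple O] (fun t : n.-tuple O => Dec (tval t) h)).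

Definition ni_ldp_protocol (eps : R) (Z H : finType) (n : nat)
    (Q : 'I_n -> Z -> probability O R) (Dec : seq O -> H -> R) : Prop :=
  (forall i, eps_LDP eps (Q i)) /\ is_decoder n Dec.

Definition succ_prob (Z H : finType) (n : nat) (Q : 'I_n -> Z -> probability O R)
    (Dec : seq O -> H -> R) (D : Z -> R) (G : pred H) : \bar R :=
  (\sum_(zs : n.-tuple Z)
      (\prod_(i < n) D (tnth zs i))%:E *
      iint [seq Q i (tnth zs i) | i <- enum 'I_n]
           (fun os => (\sum_(h : H | G h) Dec os h)%:E))%E.

Definition agn_learns (X : finType) (C : {set {ffun X -> bool}}) (alpha beta : R)
    (n : nat) (Q : 'I_n -> X * bool -> probability O R)
    (Dec : seq O -> {ffun X -> bool} -> R) : Prop :=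
  forall D : X * bool -> R, is_dist D ->
    ((1 - beta)%:E <= succ_prob Q Dec D
       (fun h : {ffun X -> bool} => [forall c in C, (loss D h <= loss D c + alpha)%R]))%E.

(** the protocol (alpha, beta)-refutes C agnostically (output true = 1, false = -1) *)
Definition agn_refutes (X : finType) (C : {set {ffun X -> bool}}) (alpha beta : R)
    (n : nat) (Q : 'I_n -> X * bool -> probability O R)
    (Dec : seq O -> bool -> R) : Prop :=
  forall D : X * bool -> R, is_dist D ->
    ([exists c in C, loss D c <= 2^-1 - alpha] ->
       ((1 - beta)%:E <= succ_prob Q Dec D (pred1 true))%E) /\
    ((forall h : {ffun X -> bool}, loss D h = 2^-1) ->
       ((1 - beta)%:E <= succ_prob Q Dec D (pred1 false))%E).

End Protocol.

Definition ldp_learnable (X : finType) (C : {set {ffun X -> bool}})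
    (eps alpha beta : R) (n : nat) : Prop :=
  exists (d : measure_display) (O : measurableType d)
         (Q : 'I_n -> X * bool -> probability O R)
         (Dec : seq O -> {ffun X -> bool} -> R),
    ni_ldp_protocol eps Q Dec /\ agn_learns C alpha beta Q Dec.

Definition ldp_refutable (X : finType) (C : {set {ffun X -> bool}})
    (eps alpha beta : R) (n : nat) : Prop :=
  exists (d : measure_display) (O : measurableType d)
         (Q : 'I_n -> X * bool -> probability O R)
         (Dec : seq O -> bool -> R),
    ni_ldp_protocol eps Q Dec /\ agn_refutes C alpha beta Q Dec.

End LDPDefs.

Arguments concept_matrix {R X} C _ _.

(* Main.v *)
Require Import Defs.
From HB Require Import structures.
From mathcomp Require Import all_boot all_order all_algebra.
From mathcomp Require Import Rstruct Rstruct_topology.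
From mathcomp Require Import all_classical all_reals all_analysis measurable_realfun.
From mathcomp Require Import ring lra complex.

(** Upper bound.  Take a factorization [Mt = L A] with [|Mt - W| <= alpha] and cost at most
    [2 gamma], so that every user holds a vector [v] of Euclidean norm at most 1.  The user reports a
    random sign vector [s] drawn with density proportional to [1 + (eps / 4) * y * phi_v (s)], where
    [phi_v (s) = Im (prod_j (1 + i v_j s_j)) / 2] is a Riesz product: it is bounded by 1, which gives
    privacy, and its degree-one Fourier coefficients are [v_j / 2], so that rescaled sums of
    [<l_c, s>] are unbiased and subgaussian estimators of the correlations with the concepts.  The
    learner outputs the concept with the best estimate, the refuter thresholds the best estimate.

    Lower bound.  Fix a concept [cs] and let [M = W - 1 cs^T], whose approximate gamma_2 norm is at
    least that of [W] minus 1.  Separating the infeasible factorizations of [M] from 0 gives dual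
    weights [(U, P, Q)].  Biasing labels along the rows of [U], rescaled so that each concept [c]
    beats [cs] by exactly [alpha], gives pairs of distributions which a learner or refuter with
    excess [alpha / 8] must tell apart (or tell one of them from random labels) for every [c],
    whereas a private randomizer has, on average over [c], chi-square divergence
    [O (eps^2 alpha^2 / g^2)] on them for every [g] below that norm.  Rescaling each row separately
    avoids losing a logarithm to dyadic bucketing, hence [alpha' = alpha / 8]. *)

Set Implicit Arguments.
Unset Strict Implicit.
Unset Printing Implicit Defensive.

Import Order.TTheory GRing.Theory Num.Theory.
Local Open Scope ring_scope.
Local Open Scope classical_set_scope.

(** * Bounded measurable functions and product expectations *)

(** Boundedness is required together with measurability so that the class is closed under products
    and consists of functions integrable against every probability measure; linearity of the
    integral then needs no side conditions. *)
Definition bmf {R : realType} d (T : measurableType d) (f : T -> R) : Prop :=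
  measurable_fun [set: T] f /\ exists M, forall x, `|f x| <= M.

Section BoundedMeasurable.
Context {R : realType} d (T : measurableType d).
Implicit Types (f g : T -> R) (P : probability T R).

Lemma bmf_cst (a : R) : bmf (fun _ : T => a).
Proof. by split=> //; exists `|a|. Qed.

Lemma bmfD f g : bmf f -> bmf g -> bmf (fun x => f x + g x).
Proof.
move=> [mf [M fM]] [mg [N gN]]; split; first exact: measurable_funD.
by exists (M + N) => x; apply: (le_trans (ler_normD _ _)); exact: lerD.
Qed.

Lemma bmfM f g : bmf f -> bmf g -> bmf (fun x => f x * g x).
Proof.
move=> [mf [M fM]] [mg [N gN]]; split; first exact: measurable_funM.
by exists (M * N) => x; rewrite normrM; apply: ler_pM.
Qed.


Lemma bmf_integrable P f : bmf f -> P.-integrable setT (EFin \o f).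
Proof.
move=> [mf [M fM]]; apply: measurable_bounded_integrable => //.
  exact: fin_num_fun_lty.
exists M; split; first exact: num_real.
by move=> y My x _; apply: (le_trans (fM x)); exact: ltW.
Qed.

End BoundedMeasurable.

Section BoundedExpectation.
Context {R : realType} d (T : measurableType d).
Implicit Types (f g : T -> R) (P : probability T R).

Lemma bmfZ (a : R) f : bmf f -> bmf (fun x => a * f x).
Proof. by move=> bf; apply: bmfM => //; exact: bmf_cst. Qed.

Lemma bmfX2 f : bmf f -> bmf (fun x => f x ^+ 2).
Proof.
move=> bf; rewrite (_ : (fun x => _) = (fun x => f x * f x)); first exact: bmfM.
by apply/funext => x; rewrite expr2.
Qed.

Lemma bmf_sum (I : Type) (s : seq I) (F : I -> T -> R) (p : pred I) :
  (forall i, p i -> bmf (F i)) -> bmf (fun x => \sum_(i <- s | p i) F i x).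
Proof.
move=> bF; elim: s => [|i s IH].
  by rewrite (_ : (fun x => _) = (fun=> 0)); [exact: bmf_cst | apply/funext => x; rewrite big_nil].
have [pi|pi] := boolP (p i).
  rewrite (_ : (fun x => _) = (fun x => F i x + \sum_(i <- s | p i) F i x)).
    by apply: bmfD => //; exact: bF.
  by apply/funext => x; rewrite big_cons pi.
rewrite (_ : (fun x => _) = (fun x => \sum_(i <- s | p i) F i x))//.
by apply/funext => x; rewrite big_cons (negbTE pi).
Qed.

Lemma bexpD P f g : bmf f -> bmf g ->
  \int[P]_x (f x + g x) = \int[P]_x f x + \int[P]_x g x.
Proof. by move=> bf bg; apply: RintegralD => //; exact: bmf_integrable. Qed.

Lemma bexpZ P (a : R) f : bmf f -> \int[P]_x (a * f x) = a * \int[P]_x f x.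
Proof. by move=> bf; apply: RintegralZl => //; exact: bmf_integrable. Qed.

Lemma bexp_cst P (a : R) : \int[P]_x a = a.
Proof.
rewrite Rintegral_cst//.
have -> : (P : {measure set T -> \bar R}) [set: T] = 1%E by exact: probability_setT.
by rewrite mulr1.
Qed.

Lemma le_bexp P f g : bmf f -> bmf g -> (forall x, f x <= g x) ->
  \int[P]_x f x <= \int[P]_x g x.
Proof. by move=> bf bg fg; apply: le_Rintegral => //; exact: bmf_integrable. Qed.

Lemma bexp_sum P (I : Type) (s : seq I) (F : I -> T -> R) :
  (forall i, bmf (F i)) ->
  \int[P]_x (\sum_(i <- s) F i x) = \sum_(i <- s) \int[P]_x F i x.
Proof.
move=> bF; elim: s => [|i s IH].
  by rewrite big_nil -[RHS](bexp_cst P); apply: eq_Rintegral => x _; rewrite big_nil.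
rewrite big_cons -IH -bexpD//; last exact: bmf_sum.
by apply: eq_Rintegral => x _; rewrite big_cons.
Qed.

Lemma bexp_EFin P f : bmf f -> (\int[P]_x (f x)%:E = (\int[P]_x f x)%:E)%E.
Proof.
move=> bf; rewrite /Rintegral fineK//.
exact: (integrable_fin_num _ (bmf_integrable P bf)).
Qed.

Lemma bexp_bound P f (M : R) : bmf f -> (forall x, `|f x| <= M) ->
  `|\int[P]_x f x| <= M.
Proof.
move=> bf fM; rewrite ler_norml; apply/andP; split.
  rewrite -[leLHS](bexp_cst P); apply: le_bexp => //; first exact: bmf_cst.
  by move=> x; have := fM x; rewrite ler_norml => /andP[].
rewrite -[leRHS](bexp_cst P); apply: le_bexp => //; first exact: bmf_cst.
by move=> x; have := fM x; rewrite ler_norml => /andP[].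
Qed.

End BoundedExpectation.

Section ParamIntegral.
Context {R : realType} d1 d2 (T : measurableType d1) (O : measurableType d2).

Lemma bmf_pair1 (f : T * O -> R) t : bmf f -> bmf (fun o => f (t, o)).
Proof.
move=> [mf [M fM]]; split; last by exists M.
exact: (measurableT_comp mf (pair1_measurable t)).
Qed.

Lemma bmf_param (P : probability O R) (f : T * O -> R) :
  bmf f -> bmf (fun t => \int[P]_o f (t, o)).
Proof.
move=> bf; have [mf [M fM]] := bf; split; last first.
  by exists M => t; apply: bexp_bound => //; exact: bmf_pair1.
(* Shifting by the bound [M] makes the integrand nonnegative, so Tonelli gives measurability in the
   parameter. *)
pose F (x : T * O) : \bar R := (f x + M)%:E.
have mF : measurable_fun setT F.
  by apply/measurable_EFinP; apply: measurable_funD.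
have F0 x : (0 <= F x)%E.
  by rewrite lee_fin; have := fM x; rewrite ler_norml; lra.
have mG := @measurable_fun_fubini_tonelli_F _ _ T O R P F mF F0.
rewrite (_ : (fun t => _) = (fun t => fine (fubini_F P F t) - M)).
  apply: measurable_funB => //.
  exact: measurableT_comp.
apply/funext => t; rewrite /fubini_F /F.
have := bexpD P (bmf_pair1 t bf) (bmf_cst O M).
by rewrite bexp_cst {1}/Rintegral => ->; rewrite addrK.
Qed.

End ParamIntegral.

Section ProductExpectation.
Context {R : realType} d (O : measurableType d).

Definition bms n (F : seq O -> R) : Prop := bmf (fun t : n.-tuple O => F (tval t)).

Lemma bmf_comp d1 d2 (T1 : measurableType d1) (T2 : measurableType d2)
    (f : T2 -> R) (r : T1 -> T2) :
  bmf f -> measurable_fun setT r -> bmf (f \o r).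
Proof.
move=> [mf [M fM]] mr; split; first exact: (measurableT_comp mf mr).
by exists M => x; exact: fM.
Qed.

(** Real-valued counterpart of [iint], indexed by a family over ['I_n] so that the users can be
    peeled off one at a time. *)
Fixpoint prodint n : ('I_n -> probability O R) -> (seq O -> R) -> R :=
  match n with
  | 0%N => fun _ F => F [::]
  | n'.+1 => fun q F =>
      \int[q ord0]_o prodint (fun i => q (lift ord0 i)) (fun os => F (o :: os))
  end.

(** The induction runs over all parameter spaces at once: the first integrated coordinate joins the
    parameter, which then ranges over [T * O]. *)
Lemma prodint_param d' (T : measurableType d') n (q : 'I_n -> probability O R)
    (G : T -> seq O -> R) :
  bmf (fun p : T * n.-tuple O => G p.1 (tval p.2)) -> bmf (fun t => prodint q (G t)).
Proof.
elim: n d' T q G => [|n IH] d' T q G bG.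
  exact: (bmf_comp bG (@pair2_measurable _ _ T (0.-tuple O) [tuple])).
pose H (p : T * O) (os : seq O) := G p.1 (p.2 :: os).
pose r (p : (T * O) * n.-tuple O) : T * n.+1.-tuple O :=
  (p.1.1, [the n.+1.-tuple O of p.1.2 :: p.2]).
have mr : measurable_fun setT r.
  apply/measurable_fun_pairP; split => /=.
    exact: (measurableT_comp measurable_fst measurable_fst).
  apply: (@measurable_cons _ _ _ _ (fun p => p.1.2) n (fun p => p.2)).
    exact: (measurableT_comp measurable_snd measurable_fst).
  exact: measurable_snd.
have bH := IH _ (T * O)%type (fun i => q (lift ord0 i)) H (bmf_comp bG mr).
exact: (bmf_param (q ord0) bH).
Qed.

Lemma bms_cons n (F : seq O -> R) (o : O) : bms n.+1 F -> bms n (fun os => F (o :: os)).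
Proof.
move=> bF.
have mc : measurable_fun setT (fun t : n.-tuple O => [the n.+1.-tuple O of o :: t]).
  by apply: measurable_cons => //; exact: measurable_id.
exact: (bmf_comp bF mc).
Qed.

Lemma prodint_bmf n (q : 'I_n -> probability O R) (F : seq O -> R) :
  bms n.+1 F -> bmf (fun o => prodint q (fun os => F (o :: os))).
Proof.
move=> bF; apply: (prodint_param q (G := fun o os => F (o :: os))).
have mc : measurable_fun setT
    (fun p : O * n.-tuple O => [the n.+1.-tuple O of p.1 :: p.2]).
  by apply: measurable_cons; [exact: measurable_fst|exact: measurable_snd].
exact: (bmf_comp bF mc).
Qed.

Lemma prodintD n (q : 'I_n -> probability O R) (F G : seq O -> R) :
  bms n F -> bms n G -> prodint q (fun os => F os + G os) = prodint q F + prodint q G.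
Proof.
elim: n q F G => [//|n IH] q F G bF bG /=.
rewrite -bexpD; [|exact: prodint_bmf..].
by apply: eq_Rintegral => o _; rewrite IH//; exact: bms_cons.
Qed.

Lemma prodintZ n (q : 'I_n -> probability O R) (a : R) (F : seq O -> R) :
  bms n F -> prodint q (fun os => a * F os) = a * prodint q F.
Proof.
elim: n q F => [//|n IH] q F bF /=.
rewrite -bexpZ; last exact: prodint_bmf.
by apply: eq_Rintegral => o _; rewrite IH//; exact: bms_cons.
Qed.

Lemma prodint_cst n (q : 'I_n -> probability O R) (a : R) : prodint q (fun=> a) = a.
Proof.
elim: n q => [//|n IH] q /=; rewrite -[RHS](bexp_cst (q ord0)).
by apply: eq_Rintegral => o _; rewrite IH.
Qed.

Lemma le_riint n (q : 'I_n -> probability O R) (F G : seq O -> R) :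
  bms n F -> bms n G -> (forall os, size os = n -> F os <= G os) ->
  prodint q F <= prodint q G.
Proof.
elim: n q F G => [|n IH] q F G bF bG FG /=; first exact: FG.
apply: le_bexp => [||o]; [exact: prodint_bmf..|].
by apply: IH => [||os sos]; [exact: bms_cons..|apply: FG; rewrite /= sos].
Qed.

Lemma iint_riint n (q : 'I_n -> probability O R) (F : seq O -> R) :
  bms n F ->
  iint [seq q i | i <- enum 'I_n] (fun os => (F os)%:E) = (prodint q F)%:E.
Proof.
elim: n q F => [|n IH] q F bF.
  by rewrite /= (_ : enum 'I_0 = [::])//; apply: size0nil; rewrite size_enum_ord.
rewrite enum_ordSl /= -map_comp -bexp_EFin; last exact: prodint_bmf.
apply: eq_integral => o _.
by rewrite -(IH (fun i => q (lift ord0 i)))//; exact: bms_cons.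
Qed.

Context (Z : finType).
Implicit Types (D : Z -> R).

(** Expectation of [g] on the report of one user whose datum has law [D]; [pexp] is the analogue for
    the whole transcript of users with i.i.d. data. *)
Definition mexp (Q : Z -> probability O R) D (g : O -> R) : R :=
  \sum_z D z * \int[Q z]_o g o.

Definition pexp n (Q : 'I_n -> Z -> probability O R) D (F : seq O -> R) : R :=
  \sum_(zs : n.-tuple Z) (\prod_(i < n) D (tnth zs i)) * prodint (fun i => Q i (tnth zs i)) F.

Lemma sum_tuple_recl n (f : n.+1.-tuple Z -> R) :
  \sum_(zs : n.+1.-tuple Z) f zs =
  \sum_z \sum_(zs : n.-tuple Z) f [tuple of z :: zs].
Proof.
rewrite pair_big /=.
rewrite (reindex (fun p : Z * n.-tuple Z => [tuple of p.1 :: p.2])) //=.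
exists (fun zs : n.+1.-tuple Z => (thead zs, [tuple of behead zs])).
  by move=> [z zs] _ /=; congr pair; apply: val_inj.
by move=> zs _ /=; rewrite [RHS]tuple_eta.
Qed.

Lemma pexp0 (Q : 'I_0 -> Z -> probability O R) D F : pexp Q D F = F [::].
Proof.
rewrite /pexp /= (bigD1 [tuple]) //= big_ord0 mul1r big1 ?addr0// => i ni.
by rewrite (tuple0 i) in ni; case/eqP: ni; exact: val_inj.
Qed.

Lemma pexpS n (Q : 'I_n.+1 -> Z -> probability O R) D F : bms n.+1 F ->
  pexp Q D F = mexp (Q ord0) D
    (fun o => pexp (fun i => Q (lift ord0 i)) D (fun os => F (o :: os))).
Proof.
move=> bF; rewrite /pexp /mexp sum_tuple_recl; apply: eq_bigr => z _.
rewrite bexp_sum; last by move=> zs; apply: bmfZ; exact: prodint_bmf.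
rewrite mulr_sumr; apply: eq_bigr => zs _.
rewrite bexpZ; last exact: prodint_bmf.
rewrite big_ord_recl tnth0 mulrA; congr (_ * _ * _).
  by apply: eq_bigr => i _; rewrite tnthS.
rewrite /= tnth0; apply: eq_Rintegral => o _.
by congr prodint; apply/funext => i; rewrite tnthS.
Qed.

Lemma pexp_bmf n (Q : 'I_n -> Z -> probability O R) D F : bms n.+1 F ->
  bmf (fun o => pexp Q D (fun os => F (o :: os))).
Proof. by move=> bF; apply: bmf_sum => zs _; apply: bmfZ; exact: prodint_bmf. Qed.

Lemma succ_probE (H : finType) n (Q : 'I_n -> Z -> probability O R)
    (Dec : seq O -> H -> R) D (G : pred H) :
  is_decoder n Dec ->
  succ_prob Q Dec D G = (pexp Q D (fun os => \sum_(h | G h) Dec os h))%:E.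
Proof.
move=> [Dge0 [D1 mD]]; rewrite /succ_prob /pexp -sumEFin; apply: eq_bigr => zs _.
rewrite EFinM iint_riint//; apply: (bmf_sum (T := n.-tuple O)) => h _.
split=> //; exists 1 => t; rewrite ger0_norm//.
by rewrite -(D1 (tval t)) (bigD1 h)//= lerDl sumr_ge0.
Qed.

Lemma prod_dist n (D : Z -> R) : is_dist D ->
  \sum_(zs : n.-tuple Z) \prod_(i < n) D (tnth zs i) = 1.
Proof.
move=> [_ D1]; elim: n => [|n IH].
  rewrite (big_pred1 [tuple]) ?big_ord0// => t; apply/esym/eqP.
  by apply: val_inj; rewrite (tuple0 t).
rewrite sum_tuple_recl -[RHS]D1; apply: eq_bigr => z _.
rewrite -[RHS]mulr1 -[X in _ = _ * X]IH mulr_sumr; apply: eq_bigr => zs _.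
rewrite big_ord_recl tnth0; congr (_ * _); by apply: eq_bigr => i _; rewrite tnthS.
Qed.

Lemma pexpD n (Q : 'I_n -> Z -> probability O R) D F G :
  bms n F -> bms n G -> pexp Q D (fun os => F os + G os) = pexp Q D F + pexp Q D G.
Proof.
move=> bF bG; rewrite /pexp -big_split; apply: eq_bigr => zs _.
by rewrite prodintD// mulrDr.
Qed.

Lemma pexpZ n (Q : 'I_n -> Z -> probability O R) D (a : R) F :
  bms n F -> pexp Q D (fun os => a * F os) = a * pexp Q D F.
Proof.
move=> bF; rewrite /pexp mulr_sumr; apply: eq_bigr => zs _.
by rewrite prodintZ// mulrCA.
Qed.

Lemma pexp_cst n (Q : 'I_n -> Z -> probability O R) D (a : R) :
  is_dist D -> pexp Q D (fun=> a) = a.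
Proof.
move=> dD; rewrite -[RHS]mul1r -(prod_dist n dD) mulr_suml.
by apply: eq_bigr => zs _; rewrite prodint_cst.
Qed.

Lemma le_pexp n (Q : 'I_n -> Z -> probability O R) D F G : is_dist D ->
  bms n F -> bms n G -> (forall os, size os = n -> F os <= G os) ->
  pexp Q D F <= pexp Q D G.
Proof.
move=> [D0 _] bF bG FG; apply: ler_sum => zs _.
by apply: ler_wpM2l; [exact: prodr_ge0|exact: le_riint].
Qed.

Lemma pexp_sum (I : Type) (s : seq I) n (Q : 'I_n -> Z -> probability O R) D
    (F : I -> seq O -> R) : (forall i, bms n (F i)) -> is_dist D ->
  pexp Q D (fun os => \sum_(i <- s) F i os) = \sum_(i <- s) pexp Q D (F i).
Proof.
move=> bF dD; elim: s => [|i s IH].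
  rewrite big_nil -[RHS](pexp_cst Q 0 dD); congr pexp.
  by apply/funext => os; rewrite big_nil.
rewrite big_cons -IH -pexpD//; last by apply: (bmf_sum (T := n.-tuple O)) => j _; exact: bF.
by congr pexp; apply/funext => os; rewrite big_cons.
Qed.

End ProductExpectation.

(** * Densities and chi-square bounds for private randomizers *)

Section Density.
Context {R : realType} d (O : measurableType d).

(* On {f > c} both integrals agree on every measurable subset, so f = c there. *)
Lemma density_clip_ae (P m : probability O R) (f : O -> R) (c : R) (b : bool) :
  m.-integrable setT (EFin \o f) ->
  (forall A, measurable A -> P A = \int[m]_(x in A) (f x)%:E)%E ->
  (forall A, measurable A ->
     if b then (P A <= c%:E * m A)%E else (c%:E * m A <= P A)%E) ->
  {ae m, forall x, if b then f x <= c else c <= f x}.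
Proof.
move=> fi PE Pc.
have mf : measurable_fun setT f by apply/measurable_EFinP; exact: measurable_int fi.
pose A : set O := if b then f @^-1` `]c, +oo[ else f @^-1` `]-oo, c[.
have mA : measurable A.
  by rewrite /A; case: ifP => _; rewrite -[X in measurable X]setTI; exact: mf.
have inA x : A x -> if b then c < f x else f x < c.
  by rewrite /A; case: ifP => _ /=; rewrite in_itv/= ?andbT.
have fiA E : measurable E -> m.-integrable E (EFin \o f).
  by move=> mE; apply: integrableS fi.
have ciA E : measurable E -> m.-integrable E (cst c%:E).
  move=> mE; apply: (integrableS measurableT) => //.
  by have := bmf_integrable m (bmf_cst O c).
have h : ae_eq m A (EFin \o f) (cst c%:E).
  apply: integral_ae_eq => //; first exact: fiA.
  move=> E EA mE; rewrite integral_cst//= -PE//.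
  have Ec := Pc _ mE; apply/eqP; rewrite eq_le.
  have [bE|bE] : b = true \/ b = false by case: (b); [left|right].
    rewrite bE in Ec inA; rewrite Ec /= PE// -integral_cst//.
    apply: le_integral => //; [exact: ciA|exact: fiA|].
    by move=> x /set_mem Ex; rewrite lee_fin ltW//; exact/inA/EA.
  rewrite bE in Ec inA; rewrite Ec andbT PE// -integral_cst//.
  apply: le_integral => //; [exact: fiA|exact: ciA|].
  by move=> x /set_mem Ex; rewrite lee_fin ltW//; exact/inA/EA.
apply: filterS h => x h.
have [bE|bE] : b = true \/ b = false by case: (b); [left|right].
all: rewrite bE.
  rewrite leNgt; apply/negP => cf.
  have Ax : A x by rewrite /A bE /= in_itv/= andbT.
  by move: (h Ax) => /= [] fc; rewrite fc ltxx in cf.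
rewrite leNgt; apply/negP => cf.
have Ax : A x by rewrite /A bE /= in_itv.
by move: (h Ax) => /= [] fc; rewrite fc ltxx in cf.
Qed.

(** The two dominations confine the Radon-Nikodym derivative to the interval almost everywhere.
    Clipping it there changes it only on a null set, and gives bounds valid at every point. *)
Lemma ldp_density (P m : probability O R) (eps : R) : 0 <= eps ->
  (forall A, measurable A -> (P A <= (expR eps)%:E * m A)%E) ->
  (forall A, measurable A -> (m A <= (expR eps)%:E * P A)%E) ->
  exists f : O -> R, [/\ measurable_fun setT f,
    forall o, expR (- eps) <= f o <= expR eps &
    forall g, bmf g -> \int[P]_o g o = \int[m]_o (g o * f o)].
Proof.
move=> eps0 Pm mP.
have dom : P `<< m.
  apply/null_content_dominatesP => A mA mA0; apply/eqP.
  by rewrite eq_le measure_ge0 andbT (le_trans (Pm _ mA))// mA0 mule0.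
pose f0 := Radon_Nikodym (charge_of_finite_measure P) m.
have f0fin x : f0 x \is a fin_num by exact: Radon_Nikodym_fin_num.
pose f1 x := fine (f0 x).
have f01 : f0 = EFin \o f1 by apply/funext => x /=; rewrite fineK.
have f1i : m.-integrable setT (EFin \o f1) by rewrite -f01; exact: Radon_Nikodym_integrable.
have f1E A : measurable A -> (P A = \int[m]_(x in A) (f1 x)%:E)%E.
  move=> mA; have := @Radon_Nikodym_integral _ _ _ (charge_of_finite_measure P) m A dom mA.
  by rewrite -/f0 f01.
have ub := @density_clip_ae P m f1 (expR eps) true f1i f1E Pm.
have lb : {ae m, forall x, expR (- eps) <= f1 x}.
  apply: (@density_clip_ae P m f1 (expR (- eps)) false f1i f1E) => A mA.
  rewrite -(@lee_pmul2l _ (expR eps)%:E)//; last by rewrite lte_fin expR_gt0.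
  rewrite muleA -EFinM -expRD subrr expR0 mul1e; exact: mP.
pose f x := Num.min (Num.max (f1 x) (expR (- eps))) (expR eps).
have mf1 : measurable_fun setT f1 by apply/measurable_EFinP; exact: measurable_int f1i.
have mf : measurable_fun setT f.
  by apply: measurable_minr => //; exact: measurable_maxr.
have fb o : expR (- eps) <= f o <= expR eps.
  rewrite /f le_min le_max lexx orbT ler_expR ge_min lexx orbT /= andbT; lra.
have bf : bmf f.
  split => //; exists (expR eps) => x; have /andP[f1x f2x] := fb x.
  by rewrite ger0_norm// (le_trans _ f1x)// expR_ge0.
exists f; split => // g bg.
rewrite /Rintegral; congr fine.
have := Radon_Nikodym_change_of_variables dom measurableT (bmf_integrable P bg).
rewrite -/f0 => <-.
apply: ae_eq_integral => //.
- apply: emeasurable_funM; first by apply/measurable_EFinP; exact: bg.1.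
  by rewrite f01; exact: measurable_int f1i.
- by apply/measurable_EFinP; exact: (bmfM bg bf).1.
apply: filterS2 ub lb => x u l _ /=.
rewrite f01 /= -EFinM; congr (_ * _)%:E.
by rewrite /f max_l// min_l.
Qed.

End Density.

(** * Chi-square bound for a single private randomizer *)

Section ChiSquare.
Context {R : realType}.

(** Squaring [1 - t / 2 <= exp (- t / 2)] bounds [exp t] by [(1 - t / 2)^-2], which a polynomial
    identity compares with [1 + 3 t]. *)
Lemma expR_le_1D3 (t : R) : 0 <= t <= 1 -> expR t <= 1 + 3 * t.
Proof.
move=> /andP[t0 t1].
have h : 1 - t / 2 <= expR (- (t / 2)) by have := expR_ge1Dx (- (t / 2)); lra.
have e1 : expR t * expR (- (t / 2)) ^+ 2 = 1.
  by rewrite expr2 -!expRD (_ : t + _ = 0) ?expR0//; field.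
have h2 : (1 - t / 2) ^+ 2 <= expR (- (t / 2)) ^+ 2.
  by rewrite ler_pXn2r// nnegrE; [lra|exact: expR_ge0].
have u0 : 0 < expR (- (t / 2)) ^+ 2 by rewrite exprn_gt0// expR_gt0.
rewrite -(ler_pM2r u0) e1; apply: (@le_trans _ _ ((1 + 3 * t) * (1 - t / 2) ^+ 2)).
  rewrite -subr_ge0 (_ : _ - _ = t * ((1 - t) * (2 - 3 * t / 4))); last by field.
  by rewrite !mulr_ge0//; lra.
by rewrite ler_wpM2l//; lra.
Qed.

(** Discriminant argument, with optimal [l = b / a]; if [a = 0], a linear function of [l] bounded
    above has slope zero. Cauchy-Schwarz bounds are derived below in this form, by summing or
    integrating a pointwise inequality with parameter [l]. *)
Lemma quadratic_sq_le (b a c : R) : 0 <= a ->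
  (forall l, 2 * l * b <= l ^+ 2 * a + c) -> b ^+ 2 <= a * c.
Proof.
rewrite le_eqVlt => /predU1P[<-|a0] h.
  have [->|b0] := eqVneq b 0; first by rewrite mul0r expr0n.
  have := h ((c + 1) / (2 * b)); rewrite mul0r mulr0 add0r.
  rewrite (_ : 2 * _ * b = c + 1); last by field.
  by move=> ?; exfalso; lra.
have := h (b / a).
rewrite (_ : 2 * (b / a) * b = 2 * (b ^+ 2 / a)); last by ring.
rewrite (_ : (b / a) ^+ 2 * a = b ^+ 2 / a); last by field; rewrite gt_eqF.
move=> h1; have : b ^+ 2 / a <= c by lra.
by rewrite ler_pdivrMr// mulrC.
Qed.

(** The law with marginal [p] on points under which the label times [f x] has mean
    [\sum_x f x * mu x]; for [mu = 0] the labels are fair coins. *)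
Definition biased (X : finType) (p mu : X -> R) (z : X * bool) : R :=
  (p z.1 + pm z.2 * mu z.1) / 2.

Lemma sum_pair_bool (X : finType) (F : X * bool -> R) :
  \sum_z F z = \sum_x (F (x, true) + F (x, false)).
Proof.
transitivity (\sum_x \sum_(y : bool) F (x, y)).
  by rewrite pair_big /=; apply: eq_bigr => -[].
by apply: eq_bigr => x _; rewrite big_bool.
Qed.

Lemma biased_dist (X : finType) (p mu : X -> R) :
  (forall x, `|mu x| <= p x) -> \sum_x p x = 1 -> is_dist (biased p mu).
Proof.
move=> mup p1; split=> [[x y]|].
  by have := mup x; rewrite ler_norml /biased /pm; case: y => /=; lra.
by rewrite sum_pair_bool -p1; apply: eq_bigr => x _; rewrite /biased /pm /=; field.
Qed.

Context d (O : measurableType d) (X : finType).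

(** This is the dual, Cauchy-Schwarz form of a bound on the chi-square divergence from the
    fair-label output law; it is the form that iterates over users. The reference law [m] is the
    output law at one input, and [h x] is half the difference of the densities for the two labels at
    [x]. Neither depends on [p] or [mu], so one [h] serves a whole family of perturbations. *)
Lemma ldp_chi_square (Q : X * bool -> probability O R) (eps : R) (x0 : X) :
  0 <= eps <= 1 -> eps_LDP eps Q ->
  exists (m : probability O R) (h : X -> O -> R),
    [/\ forall x, measurable_fun setT (h x),
        forall x o, `|h x o| <= 2 * eps &
        forall (p mu : X -> R) g, (forall x, `|mu x| <= p x) -> \sum_x p x = 1 ->
          bmf g ->
          mexp Q (biased p mu) g ^+ 2 <=
          (1 + 4 * \int[m]_o (\sum_x mu x * h x o) ^+ 2) *
          mexp Q (biased p (fun=> 0)) (fun o => g o ^+ 2)].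
Proof.
move=> /andP[eps0 eps1] ldp.
pose m := Q (x0, true).
have /choice[f fP] : forall z, exists f : O -> R, [/\ measurable_fun setT f,
    forall o, expR (- eps) <= f o <= expR eps &
    forall g, bmf g -> \int[Q z]_o g o = \int[m]_o (g o * f o)].
  by move=> z; apply: (@ldp_density _ _ _ _ _ eps) => // A mA; exact: ldp.
have fb z o : 1 - eps <= f z o <= 1 + 3 * eps.
  have [_ /(_ o)/andP[f1 f2] _] := fP z.
  have := expR_ge1Dx (- eps); have := @expR_le_1D3 eps; rewrite eps0 eps1 => /(_ isT).
  by move=> ? ?; apply/andP; split; lra.
(* The bound [1 - eps] degenerates at [eps = 1], so a positive lower bound is taken from
   [exp (- eps) >= (1 + 3 eps)^-1]. *)
have f14 z o : 4^-1 <= f z o.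
  have [_ /(_ o)/andP[f1 f2] _] := fP z.
  apply: le_trans f1; rewrite expRN lef_pV2 ?posrE ?expR_gt0//.
  by have := @expR_le_1D3 eps; rewrite eps0 eps1 => /(_ isT); lra.
have bf z : bmf (f z).
  have [mf _ _] := fP z; split => //; exists 4 => o.
  by have := fb z o; have := f14 z o; rewrite ler_norml; lra.
pose h x o := (f (x, true) o - f (x, false) o) / 2.
have bh x : bmf (h x).
  rewrite (_ : h x = fun o => 2^-1 * f (x, true) o + (- 2^-1) * f (x, false) o).
    by apply: bmfD; exact: bmfZ.
  by apply/funext => o; rewrite /h; ring.
have hb x o : `|h x o| <= 2 * eps.
  have := fb (x, true) o; have := fb (x, false) o.
  by rewrite ler_norml /h; lra.
exists m, h; split => //; first by move=> x; exact: (bh x).1.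
move=> p mu g mup p1 bg.
(* [f0] is the density of the report under fair labels, and [f0 + v] its density under
   [biased p mu]. *)
pose f0 o := \sum_x p x * ((f (x, true) o + f (x, false) o) / 2).
pose v o := \sum_x mu x * h x o.
have bf0 : bmf f0.
  apply: bmf_sum => x _; apply: bmfZ.
  rewrite (_ : (fun o => _) = fun o => 2^-1 * f (x, true) o + 2^-1 * f (x, false) o).
    by apply: bmfD; exact: bmfZ.
  by apply/funext => o; ring.
have bv : bmf v by apply: bmf_sum => x _; exact: bmfZ.
have p0 x : 0 <= p x by exact: le_trans (mup x).
have d0 : is_dist (biased p (fun=> 0)).
  by apply: biased_dist => // x; rewrite normr0.
have f0_14 o : 4^-1 <= f0 o.
  rewrite -[leLHS]mul1r -[X in X * _ <= _]p1 mulr_suml; apply: ler_sum => x _.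
  by apply: ler_wpM2l => //; have := f14 (x, true) o; have := f14 (x, false) o; lra.
have mexpE g' mu' : bmf g' -> mexp Q (biased p mu') g' =
    \int[m]_o (g' o * (f0 o + \sum_x mu' x * h x o)).
  move=> bg'; rewrite /mexp.
  under eq_bigr => z _.
    have [_ _ ->//] := fP z.
    rewrite -bexpZ; last exact: bmfM.
    over.
  rewrite -bexp_sum; last by move=> z; apply: bmfZ; exact: bmfM.
  apply: eq_Rintegral => o _; rewrite sum_pair_bool /f0 -big_split mulr_sumr /=.
  by apply: eq_bigr => x _; rewrite /biased /h /pm /=; field.
have int_f z : \int[m]_o f z o = 1.
  have [_ _ /(_ _ (bmf_cst O 1))] := fP z; rewrite bexp_cst => ->.
  by apply: eq_Rintegral => o _; rewrite mul1r.
have int_h x : \int[m]_o h x o = 0.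
  transitivity (\int[m]_o (2^-1 * f (x, true) o + (- 2^-1) * f (x, false) o)).
    by apply: eq_Rintegral => o _; rewrite /h; ring.
  by rewrite bexpD ?bexpZ ?int_f//; try exact: bmfZ; lra.
have int_v : \int[m]_o v o = 0.
  rewrite bexp_sum; last by move=> x; exact: bmfZ.
  by rewrite big1// => x _; rewrite bexpZ// int_h mulr0.
have int_f0 : \int[m]_o f0 o = 1.
  have := mexpE (fun=> 1) (fun=> 0) (bmf_cst O 1).
  rewrite /mexp; under eq_bigr do rewrite bexp_cst mulr1.
  rewrite d0.2 => ->; apply: eq_Rintegral => o _; rewrite mul1r big1 ?addr0// => x _.
  by rewrite mul0r.
have bg2 := bmfX2 bg.
rewrite [leRHS]mulrC; apply: quadratic_sq_le.
  apply: sumr_ge0 => z _; apply: mulr_ge0.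
    exact: d0.1.
  by apply: Rintegral_ge0 => o _; exact: sqr_ge0.
move=> l; rewrite !mexpE//.
have bv2 := bmfX2 bv.
have -> : \int[m]_o (g o ^+ 2 * (f0 o + \sum_x 0 * h x o)) = \int[m]_o (g o ^+ 2 * f0 o).
  by apply: eq_Rintegral => o _; rewrite big1 ?addr0// => x _; rewrite mul0r.
(* Adding [2 v], which integrates to zero, turns the claim into a pointwise inequality whose defect
   is a sum of two squares once [f0 >= 1 / 4]. *)
have -> : 1 + 4 * \int[m]_o (\sum_x mu x * h x o) ^+ 2 =
    \int[m]_o (f0 o + (2 * v o + 4 * v o ^+ 2)).
  rewrite !bexpD ?bexpZ ?int_v ?int_f0 ?mulr0 ?add0r//.
  - exact: bmfZ.
  - exact: bmfZ.
  - by apply: bmfD; exact: bmfZ.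
have bgf : bmf (fun o => g o ^+ 2 * f0 o) by exact: bmfM.
have bgv : bmf (fun o => g o * (f0 o + v o)) by apply: bmfM => //; exact: bmfD.
have brest : bmf (fun o => f0 o + (2 * v o + 4 * v o ^+ 2)).
  by apply: bmfD => //; apply: bmfD; exact: bmfZ.
rewrite -!bexpZ// -bexpD//; last exact: bmfZ.
apply: le_bexp => [||o]; [exact: bmfZ|by apply: bmfD => //; exact: bmfZ|].
have := f0_14 o; rewrite -/(v o); move: (f0 o) (v o) (g o) => a b c a4.
rewrite -subr_ge0 (_ : _ - _ = (a - 4^-1) * (l * c - 1) ^+ 2 +
   ((l * c - 1) / 2 - 2 * b) ^+ 2); last by field.
by rewrite addr_ge0 ?sqr_ge0// mulr_ge0 ?sqr_ge0//; lra.
Qed.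

End ChiSquare.

(** * From one user to the whole transcript *)

Section Tensorization.
Context {R : realType} d (O : measurableType d) (Z : finType).
Implicit Types (D : Z -> R).

(** The first user's inequality is applied to the conditional expectation of [F] given the first
    report; the induction hypothesis then bounds its square report by report. *)
Lemma pexp_chi_square n (Q : 'I_n -> Z -> probability O R) D1 D0 (S : 'I_n -> R) F :
  (forall z, 0 <= D0 z) -> (forall i, 0 <= S i) ->
  (forall i g, bmf g ->
     mexp (Q i) D1 g ^+ 2 <= (1 + S i) * mexp (Q i) D0 (fun o => g o ^+ 2)) ->
  bms n F ->
  pexp Q D1 F ^+ 2 <= (\prod_i (1 + S i)) * pexp Q D0 (fun os => F os ^+ 2).
Proof.
move=> D00; elim: n Q S F => [|n IH] Q S F S0 chi bF.
  by rewrite !pexp0 big_ord0 mul1r.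
have bF2 : bms n.+1 (fun os => F os ^+ 2) by exact: bmfX2.
rewrite !pexpS// big_ord_recl -mulrA.
apply: (le_trans (chi ord0 _ (pexp_bmf _ _ bF))).
apply: ler_wpM2l; first by rewrite addr_ge0.
rewrite /mexp mulr_sumr; apply: ler_sum => z _; rewrite mulrCA.
apply: ler_wpM2l => //; rewrite -bexpZ; last exact: (pexp_bmf _ _ bF2).
apply: le_bexp => [||o].
- exact: bmfX2 (pexp_bmf _ _ bF).
- exact: bmfZ (pexp_bmf _ _ bF2).
by apply: (IH _ (fun i => S (lift ord0 i))) => // [i g|]; [exact: chi|exact: bms_cons].
Qed.

(* Apply the Cauchy-Schwarz bound above to F + l and optimise over the shift l. *)
Lemma pexp_sub_sq_le n (Q : 'I_n -> Z -> probability O R) D1 D0 (S : 'I_n -> R) F :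
  is_dist D0 -> is_dist D1 -> (forall i, 0 <= S i) ->
  (forall i g, bmf g ->
     mexp (Q i) D1 g ^+ 2 <= (1 + S i) * mexp (Q i) D0 (fun o => g o ^+ 2)) ->
  bms n F -> (forall os, 0 <= F os <= 1) ->
  (pexp Q D1 F - pexp Q D0 F) ^+ 2 <= \sum_i S i.
Proof.
move=> dD0 dD1 S0 chi bF F01.
set b := pexp Q D1 F; set a := pexp Q D0 F.
have bc (c : R) : bms n (fun=> c) by exact: bmf_cst.
have in01 D : is_dist D -> 0 <= pexp Q D F <= 1.
  move=> dD; apply/andP; split.
    by rewrite -[leLHS](pexp_cst Q 0 dD); apply: le_pexp => // os _; have /andP[] := F01 os.
  by rewrite -[leRHS](pexp_cst Q 1 dD); apply: le_pexp => // os _; have /andP[] := F01 os.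
have /andP[a0 a1] := in01 _ dD0; have /andP[b0 b1] := in01 _ dD1.
have SS0 : 0 <= \sum_i S i by exact: sumr_ge0.
(* When the sum exceeds 1 the claim is trivial, both expectations lying in [[0, 1]]; otherwise the
   product is at most linear in the sum. *)
have [S1|S1] := leP (\sum_i S i) 1; last first.
  by apply: le_trans (ltW S1); rewrite -/a -/b in a0 a1 b0 b1; nra.
set P := \prod_i (1 + S i).
have PS : P <= 1 + 3 * \sum_i S i.
  apply: le_trans (expR_le_1D3 _); last by rewrite SS0.
  rewrite expR_sum; apply: ler_prod => i _; rewrite expR_ge1Dx andbT addr_ge0//.
have P1 : 1 <= P.
  by rewrite /P; elim/big_ind: _ => // [x y x1 y1|i _];
    [exact: mulr_ege1|rewrite lerDl].
(* Since [F^2 <= F], the second moment of [F + l] under [D0] is at most [a + 2 l a + l^2], the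
   Bernoulli variance plus the squared mean. *)
have key l : (b + l) ^+ 2 <= P * (a - a ^+ 2 + (a + l) ^+ 2).
  have bFl : bms n (fun os => F os + l) by apply: bmfD => //; exact: bc.
  have := pexp_chi_square dD0.1 S0 chi bFl.
  rewrite pexpD// pexp_cst// -/b => /le_trans; apply.
  apply: ler_wpM2l; first by rewrite (le_trans _ P1).
  rewrite (_ : a - a ^+ 2 + (a + l) ^+ 2 = a + (2 * l * a + l ^+ 2)); last by ring.
  rewrite -(pexpZ Q D0 (2 * l) bF) -[X in _ + (_ + X)](pexp_cst Q (l ^+ 2) dD0).
  have b2 : bms n (fun os => 2 * l * F os) by apply: bmfZ; exact: bF.
  have b3 : bms n (fun os => 2 * l * F os + l ^+ 2) by apply: bmfD => //; exact: bc.
  rewrite -pexpD// -pexpD//.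
  apply: le_pexp => // [||os _]; [exact: bmfX2|exact: bmfD|].
  by have := F01 os; nra.
(* For [P = 1] the inequality is affine in [l], so a large shift forces [a = b]. *)
have [P1E|P1n] := eqVneq P 1.
  have [->|ba] := eqVneq b a; first by rewrite subrr expr0n.
  have := key ((1 / (2 * (b - a))) - a); rewrite P1E mul1r.
  rewrite (_ : b + (_ - a) = (b - a) + 1 / (2 * (b - a))); last by ring.
  rewrite (_ : a + (_ - a) = 1 / (2 * (b - a))); last by ring.
  rewrite sqrrD (_ : ((b - a) * _) *+ 2 = 1); last by field; rewrite subr_eq0.
  by move=> h; exfalso; have := sqr_ge0 (b - a); nra.
have P1' : 0 < P - 1 by rewrite subr_gt0 lt_neqAle eq_sym P1n.
(* The optimal shift, yielding [(b - a)^2 <= (P - 1) (a - a^2)]; the factors 3 and 1/4 then leave a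
   constant below 1. *)
have := key ((b - a) / (P - 1) - a).
rewrite (_ : b + (_ - a) = (b - a) * (P / (P - 1))); last by field; rewrite gt_eqF.
rewrite (_ : a + (_ - a) = (b - a) / (P - 1)); last by ring.
move: (b - a) => x key'.
have : P * (x ^+ 2 / (P - 1)) <= P * (a - a ^+ 2).
  rewrite -subr_ge0; move: key'; rewrite -subr_ge0.
  suff -> : P * (a - a ^+ 2 + (x / (P - 1)) ^+ 2) - (x * (P / (P - 1))) ^+ 2 =
    P * (a - a ^+ 2) - P * (x ^+ 2 / (P - 1)) by [].
  by field; rewrite gt_eqF.
rewrite ler_pM2l ?(lt_le_trans ltr01)// ler_pdivrMr// => h.
apply: (le_trans h).
have : a - a ^+ 2 <= 4^-1 by have := sqr_ge0 (a - 2^-1); nra.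
have : 0 <= a - a ^+ 2 by nra.
move: (a - a ^+ 2) => v v0 v4; nra.
Qed.

End Tensorization.

(** * Factorizations and duality *)

Section Separation.
Import numFieldNormedType.Exports.
Context {R : realType}.

Lemma continuous_sum_coord n (f : 'I_n -> R -> R) :
  (forall i, continuous (f i)) ->
  continuous (fun v : 'rV[R]_n => \sum_i f i (v ord0 i)).
Proof.
move=> cf; elim: (index_enum 'I_n) => [|i s IH] v.
  rewrite (_ : (fun v => _) = cst 0); first exact: cst_continuous.
  by apply/funext => w; rewrite big_nil.
rewrite (_ : (fun v => _) = (fun v : 'rV[R]_n => f i (v ord0 i) + \sum_(j <- s) f j (v ord0 j))).
  apply: continuousD; last exact: IH.
  apply: (@continuous_comp _ _ _ (fun w : 'rV[R]_n => w ord0 i) (f i)).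
    exact: coord_continuous.
  exact: cf.
by apply/funext => w; rewrite big_cons.
Qed.

Lemma closure_ge n (f : 'rV[R]_n -> R) (A : set 'rV[R]_n) (c : R) :
  continuous f -> (forall v, A v -> c <= f v) -> forall v, closure A v -> c <= f v.
Proof.
move=> cf Af v clv.
have cl : closed [set v | c <= f v].
  exact: ((continuous_closedP _).1 cf _ (@closed_ge _ c)).
by have := closureS Af clv; rewrite -(closure_id _).1.
Qed.

(* The separating functional is the point of minimal norm in the closure. *)
Lemma separation_from_0 n (S : set 'rV[R]_n) (d : R) :
  S !=set0 -> 0 < d ->
  (forall u v t, S u -> S v -> 0 <= t <= 1 -> S (t *: u + (1 - t) *: v)) ->
  (forall v, S v -> d <= \sum_i v ord0 i ^+ 2) ->
  exists c : 'rV[R]_n, forall v, S v -> d <= \sum_i c ord0 i * v ord0 i.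
Proof.
move=> [x0 Sx0] d0 cvx Sd.
pose N (v : 'rV[R]_n) := \sum_i v ord0 i ^+ 2.
have cN : continuous N.
  apply: (continuous_sum_coord (f := fun _ x => x ^+ 2)) => _ x.
  exact: exprn_continuous.
pose A := closure S `&` [set v | N v <= N x0].
have clA : closed A.
  apply: closedI; first exact: closed_closure.
  exact: ((continuous_closedP _).1 cN _ (@closed_le _ _)).
have bA : bounded_set A.
  exists (1 + N x0); split; first exact: num_real.
  move=> M ltM v [_ /= Nv]; rewrite /Num.norm /= mx_normrE.
  have N0 : 0 <= N x0 by apply: sumr_ge0 => i _; exact: sqr_ge0.
  apply: bigmax_le => [|[i j] _]; first lra.
  rewrite (ord1 i) /=.
  have vj : v ord0 j ^+ 2 <= N x0.
    by apply: le_trans Nv; rewrite /N (bigD1 j)//= lerDl sumr_ge0// => k _; exact: sqr_ge0.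
  by rewrite ler_norml; apply/andP; split; nra.
have [c cA cmin] := @EVT_min_rV R n N A (ex_intro _ x0 (conj (subset_closure Sx0) (lexx _)))
  (bounded_closed_compact bA clA) (continuous_subspaceT cN).
have [clc Nc] := set_mem cA.
have Nmin v : S v -> N c <= N v.
  move=> Sv; have [Nv|Nv] := leP (N v) (N x0).
    by apply: cmin; apply/mem_set; split => //; exact: subset_closure.
  exact: le_trans Nc (ltW Nv).
have dNc : d <= N c by apply: (closure_ge cN Sd).
exists c => y Sy; set cy := \sum_i _.
(* The right side is the squared norm of [t c + (1 - t) y]. Since [c] lies only in the closure of
   [S], minimality is first used at points of [S] and then passes to the limit. *)
have key t : 0 <= t <= 1 ->
    N c <= t ^+ 2 * N c + 2 * (t * (1 - t)) * cy + (1 - t) ^+ 2 * N y.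
  move=> t01.
  have -> : t ^+ 2 * N c + 2 * (t * (1 - t)) * cy + (1 - t) ^+ 2 * N y =
      \sum_i (t * c ord0 i + (1 - t) * y ord0 i) ^+ 2.
    rewrite /N /cy !mulr_sumr -!big_split /=; apply: eq_bigr => i _; ring.
  pose f i (x : R) := (t * x + (1 - t) * y ord0 i) ^+ 2.
  have cf i : continuous (f i).
    move=> x; rewrite /f.
    apply: (@continuous_comp _ _ _ (fun x => t * x + (1 - t) * y ord0 i) (fun x => x ^+ 2)).
      by apply: cvgD; [apply: cvgM; [exact: cvg_cst|exact: cvg_id]|exact: cvg_cst].
    exact: exprn_continuous.
  apply: (closure_ge (continuous_sum_coord cf) _ clc) => v Sv.
  rewrite (_ : \sum_i _ = N (t *: v + (1 - t) *: y)); first exact: Nmin (cvx _ _ _ Sv Sy t01).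
  by apply: eq_bigr => i _; rewrite /f !mxE.
(* If the inner product with [y] were below [N c], a small step [s] from [c] towards [y] would
   decrease the norm at first order; [B] is large enough to dominate the second-order terms. *)
apply: (le_trans dNc); rewrite leNgt; apply/negP => lt_cy.
have Ny0 : 0 <= N y by apply: sumr_ge0 => i _; exact: sqr_ge0.
pose e := N c - cy; have e0 : 0 < e by rewrite subr_gt0.
pose B := N c + 2 * `|cy| + N y + e.
have B0 : e <= B by rewrite /B; have := normr_ge0 cy; lra.
have Bp : 0 < B by lra.
pose s := e / B.
have s1 : s <= 1 by rewrite ler_pdivrMr// mul1r.
have s0 : 0 < s by rewrite divr_gt0.
have sB : s * B = e by rewrite /s divfK// gt_eqF.
have := key (1 - s).
have -> : 0 <= 1 - s <= 1 by apply/andP; split; lra.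
move=> /(_ isT) h.
have : 2 * e <= s * (N c - 2 * cy + N y).
  by rewrite -(ler_pM2l s0) /e; nra.
have : s * (N c - 2 * cy + N y) <= s * B.
  rewrite ler_pM2l// /B; have := ler_norm (- cy); rewrite normrN; lra.
rewrite sB; lra.
Qed.

Lemma separation_from_0_fun (T : finType) (S : set (T -> R)) (d : R) :
  S !=set0 -> 0 < d ->
  (forall u v t, S u -> S v -> 0 <= t <= 1 -> S (fun x => t * u x + (1 - t) * v x)) ->
  (forall v, S v -> d <= \sum_x v x ^+ 2) ->
  exists c : T -> R, forall v, S v -> d <= \sum_x c x * v x.
Proof.
move=> [x0 Sx0] d0 cvx Sd.
pose F (v : 'rV[R]_#|T|) (x : T) := v ord0 (enum_rank x).
have Fsum (h : T -> R) : \sum_(i < #|T|) h (enum_val i) = \sum_x h x.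
  rewrite (reindex enum_rank) /=; first by apply: eq_bigr => x _; rewrite enum_rankK.
  by exists enum_val => x _; rewrite ?enum_rankK ?enum_valK.
pose G (v : T -> R) : 'rV[R]_#|T| := \row_i v (enum_val i).
have FG v : F (G v) = v by apply/funext => x; rewrite /F mxE enum_rankK.
have [||v Sv|c cP] := @separation_from_0 _ [set v | S (F v)] d _ d0.
- by exists (G x0); rewrite /= FG.
- move=> u v t Su Sv t01 /=.
  rewrite (_ : F _ = fun x => t * F u x + (1 - t) * F v x); first exact: cvx.
  by apply/funext => x; rewrite /F !mxE.
- apply: (le_trans (Sd _ Sv)); rewrite -Fsum; apply: ler_sum => i _.
  by rewrite /F enum_valK.
exists (F c) => v Sv; have := cP (G v); rewrite /= FG => /(_ Sv) /le_trans; apply.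
by rewrite -Fsum; apply: ler_sum => i _; rewrite /F enum_valK mxE.
Qed.

End Separation.

(** * Balanced factorizations and the factorization norms *)

Section Factorization.
Context {R : realType}.

(* A factorization of cost at most r, rescaled so that both factors have norm at most sqrt r. *)
Definition balanced (I J : finType) (M : I -> J -> R) (r : R) : Prop :=
  exists (K : finType) (L : I -> K -> R) (A : K -> J -> R),
    [/\ forall i j, \sum_l L i l * A l j = M i j,
        forall i, \sum_l L i l ^+ 2 <= r &
        forall j, \sum_l A l j ^+ 2 <= r].

Definition approx_balanced (I J : finType) (M : I -> J -> R) (alpha r : R) : Prop :=
  exists2 Mt : I -> J -> R, (forall i j, `|Mt i j - M i j| <= alpha) & balanced Mt r.

Lemma sum_enum_val (K : finType) (F : K -> R) :
  \sum_(l < #|K|) F (enum_val l) = \sum_l F l.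
Proof.
rewrite (reindex enum_rank) /=; first by apply: eq_bigr => x _; rewrite enum_rankK.
by exists enum_val => x _; rewrite ?enum_rankK ?enum_valK.
Qed.

(** Concatenating the inner index sets adds the products as well as the squared row and column
    norms. *)
Lemma balancedD (I J : finType) (M1 M2 : I -> J -> R) r1 r2 :
  balanced M1 r1 -> balanced M2 r2 -> balanced (fun i j => M1 i j + M2 i j) (r1 + r2).
Proof.
move=> [K1 [L1 [A1 [E1 l1 a1]]]] [K2 [L2 [A2 [E2 l2 a2]]]].
exists (K1 + K2)%type,
  (fun i k => match k with inl l => L1 i l | inr l => L2 i l end),
  (fun k j => match k with inl l => A1 l j | inr l => A2 l j end).
split=> [i j|i|j]; rewrite big_sumType /=; [by rewrite E1 E2|exact: lerD..].
Qed.

Lemma balanced_entry (I J : finType) (M : I -> J -> R) r i j : balanced M r -> `|M i j| <= r.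
Proof.
move=> [K [L [A [E l a]]]].
have h (s : R) : s ^+ 2 = 1 -> s * M i j <= r.
  move=> s2; rewrite -E mulr_sumr.
  apply: (@le_trans _ _ (\sum_k (2^-1 * L i k ^+ 2 + 2^-1 * A k j ^+ 2))).
    apply: ler_sum => k _; have := sqr_ge0 (s * L i k - A k j).
    rewrite sqrrB exprMn s2; lra.
  rewrite big_split /= -!mulr_sumr; have := l i; have := a j; lra.
have := h 1; have := h (-1); rewrite sqrrN expr1n mulN1r mul1r => /(_ erefl) h1 /(_ erefl) h2.
by rewrite ler_norml; apply/andP; split; lra.
Qed.

Lemma fact_cost_ge0 (I J : finType) k (L : I -> 'I_k -> R) (A : 'I_k -> J -> R) :
  0 <= fact_cost L A.
Proof. by apply: mulr_ge0; apply: bigmax_ge_id. Qed.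

Lemma gamma2_le (I J : finType) (M : I -> J -> R) r : balanced M r -> 0 <= r -> gamma2 M <= r.
Proof.
move=> [K [L [A [E l a]]]] r0.
pose L' i (k : 'I_#|K|) := L i (enum_val k).
pose A' (k : 'I_#|K|) j := A (enum_val k) j.
apply: (@le_trans _ _ (fact_cost L' A')).
  apply: ge_inf.
    by exists 0 => _ [k [L0 [A0 [_ ->]]]]; exact: fact_cost_ge0.
  exists #|K|, L', A'; split => // i j.
  by rewrite -E -[RHS]sum_enum_val.
rewrite -[leRHS]sqr_sqrtr// expr2 /fact_cost; apply: ler_pM.
- exact: bigmax_ge_id.
- exact: bigmax_ge_id.
- apply: bigmax_le => [|i _]; first exact: sqrtr_ge0.
  by rewrite ler_sqrt// (sum_enum_val (fun k => L i k ^+ 2)).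
- apply: bigmax_le => [|j _]; first exact: sqrtr_ge0.
  by rewrite ler_sqrt// (sum_enum_val (fun k => A k j ^+ 2)).
Qed.

Lemma gamma2_balanced (I J : finType) (M : I -> J -> R) r : gamma2 M < r -> balanced M r.
Proof.
move=> /inf_lt [|_ [k [L [A [E ->]]]]].
  (* The infimum ranges over a nonempty set, thanks to the factorization of [M] through the
     identity. *)
  exists (fact_cost (fun i (l : 'I_#|I|) => (enum_rank i == l)%:R)
                    (fun (l : 'I_#|I|) j => M (enum_val l) j)).
  exists #|I|, (fun i (l : 'I_#|I|) => (enum_rank i == l)%:R),
    (fun (l : 'I_#|I|) j => M (enum_val l) j); split => // i j.
  rewrite (bigD1 (enum_rank i))//= eqxx mul1r enum_rankK big1 ?addr0// => l.
  by rewrite eq_sym => /negPf ->; rewrite mul0r.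
rewrite /fact_cost.
set a := \big[_/_]_i _; set b := \big[_/_]_j _ => abr.
have a0 : 0 <= a by exact: bigmax_ge_id.
have b0 : 0 <= b by exact: bigmax_ge_id.
have r0 : 0 < r by apply: le_lt_trans abr; exact: mulr_ge0.
have La i : \sum_l L i l ^+ 2 <= a ^+ 2.
  rewrite -[leLHS]sqr_sqrtr; last by apply: sumr_ge0 => l _; exact: sqr_ge0.
  rewrite ler_pXn2r ?nnegrE ?sqrtr_ge0//.
  exact: (le_bigmax _ (fun i => Num.sqrt (\sum_(l < k) L i l ^+ 2))).
have Ab j : \sum_l A l j ^+ 2 <= b ^+ 2.
  rewrite -[leLHS]sqr_sqrtr; last by apply: sumr_ge0 => l _; exact: sqr_ge0.
  rewrite ler_pXn2r ?nnegrE ?sqrtr_ge0//.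
  exact: (le_bigmax _ (fun j => Num.sqrt (\sum_(l < k) A l j ^+ 2))).
(* If one factor vanishes the norms cannot be equalised, but then [M = 0]. *)
have zero : (forall i j, M i j = 0) -> balanced M r.
  move=> M0; exists void, (fun _ _ => 0), (fun _ _ => 0).
  by split=> [i j|i|j]; rewrite big_pred0 ?M0// ?ltW// => -[].
have sq0 (h : 'I_k -> R) : \sum_l h l ^+ 2 <= 0 -> forall l, h l = 0.
  move=> h0 l; apply/eqP; rewrite -sqrf_eq0 eq_le sqr_ge0 andbT.
  by apply: le_trans h0; rewrite (bigD1 l)//= lerDl sumr_ge0// => *; exact: sqr_ge0.
have [az|an] := eqVneq a 0.
  apply: zero => i j; rewrite -E big1// => l _.
  by rewrite (sq0 (L i)) ?mul0r//; have := La i; rewrite az expr0n.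
have [bz|bn] := eqVneq b 0.
  apply: zero => i j; rewrite -E big1// => l _.
  by rewrite (sq0 (A ^~ j)) ?mulr0//; have := Ab j; rewrite bz expr0n.
have ap : 0 < a by rewrite lt_neqAle eq_sym an.
have bp : 0 < b by rewrite lt_neqAle eq_sym bn.
(* This scaling brings both norms to [sqrt (a b)]. *)
pose s := Num.sqrt (b / a).
have s2 : s ^+ 2 = b / a by rewrite sqr_sqrtr// divr_ge0.
have s0 : 0 < s by rewrite sqrtr_gt0 divr_gt0.
exists 'I_k, (fun i l => s * L i l), (fun l j => s^-1 * A l j); split=> [i j|i|j].
- by rewrite -E; apply: eq_bigr => l _; field; rewrite gt_eqF.
- under eq_bigr do rewrite exprMn s2.
  rewrite -mulr_sumr; apply: le_trans (ltW abr).
  rewrite -[leRHS](_ : b / a * a ^+ 2 = _); last by field.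
  by rewrite ler_wpM2l// divr_ge0.
- under eq_bigr do rewrite exprMn exprVn s2.
  rewrite -mulr_sumr; apply: le_trans (ltW abr).
  rewrite -[leRHS](_ : (b / a)^-1 * b ^+ 2 = _); last by field; rewrite bn an.
  by rewrite ler_wpM2l// invr_ge0 divr_ge0.
Qed.

Lemma inf_ge0 (E : set R) : (forall x, E x -> 0 <= x) -> 0 <= inf E.
Proof.
move=> E0; have [E0'|] := pselect (E !=set0); first exact: lb_le_inf.
by move=> /set0P/negP/negPn/eqP ->; rewrite inf0.
Qed.

Lemma gamma2_ge0 (I J : finType) (M : I -> J -> R) : 0 <= gamma2 M.
Proof. by apply: inf_ge0 => _ [k [L [A [_ ->]]]]; exact: fact_cost_ge0. Qed.

Lemma gamma2_approx_le (I J : finType) (M : I -> J -> R) alpha r :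
  0 <= r -> approx_balanced M alpha r -> gamma2_approx M alpha <= r.
Proof.
move=> r0 [Mt Mta gMt]; apply: le_trans (gamma2_le gMt r0).
apply: ge_inf; last by exists Mt.
by exists 0 => _ [? [_ ->]]; exact: gamma2_ge0.
Qed.

Lemma gamma2_approx_balanced (I J : finType) (M : I -> J -> R) alpha r :
  0 <= alpha -> gamma2_approx M alpha < r -> approx_balanced M alpha r.
Proof.
move=> a0 /inf_lt [|_ [Mt [Mta ->]] lt_r].
  by exists (gamma2 M), M; split => // i j; rewrite subrr normr0.
by exists Mt => //; exact: gamma2_balanced.
Qed.

End Factorization.

(** * Dual certificates for the approximate factorization norm *)

Section Duality.
Context {R : realType} (I J : finType) (M : I -> J -> R) (alpha : R).
Hypothesis alpha0 : 0 <= alpha.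

(* Approximate factorizations of M whose squared row and column norms exceed g by at most the slacks. *)
Let feasible (g : R) (v : (I * J) + (I + J) -> R) : Prop :=
  exists (K : finType) (L : I -> K -> R) (A : K -> J -> R),
    [/\ forall i j, `|v (inl (i, j)) - (M i j - \sum_l L i l * A l j)| <= alpha,
        forall i, v (inr (inl i)) <= g - \sum_l L i l ^+ 2 &
        forall j, v (inr (inr j)) <= g - \sum_l A l j ^+ 2].

(** Concatenating the factorizations with weights [sqrt t] and [sqrt (1 - t)] averages their
    products and squared norms. The unrestricted inner dimension makes this possible. *)
Lemma feasible_convex g u v t : feasible g u -> feasible g v -> 0 <= t <= 1 ->
  feasible g (fun x => t * u x + (1 - t) * v x).
Proof.
move=> [K1 [L1 [A1 [E1 l1 a1]]]] [K2 [L2 [A2 [E2 l2 a2]]]] /andP[t0 t1].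
have s0 : 0 <= 1 - t by lra.
exists (K1 + K2)%type,
  (fun i k => match k with inl l => Num.sqrt t * L1 i l
                         | inr l => Num.sqrt (1 - t) * L2 i l end),
  (fun k j => match k with inl l => Num.sqrt t * A1 l j
                         | inr l => Num.sqrt (1 - t) * A2 l j end).
have sq (K : finType) (f h : K -> R) s : 0 <= s ->
    \sum_l (Num.sqrt s * f l) * (Num.sqrt s * h l) = s * \sum_l f l * h l.
  move=> sge0; rewrite mulr_sumr; apply: eq_bigr => l _.
  by rewrite mulrACA -expr2 sqr_sqrtr.
have sq2 (K : finType) (f : K -> R) s : 0 <= s ->
    \sum_l (Num.sqrt s * f l) ^+ 2 = s * \sum_l f l ^+ 2.
  by move=> sge0; rewrite mulr_sumr; apply: eq_bigr => l _; rewrite exprMn sqr_sqrtr.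
split=> [i j|i|j]; rewrite big_sumType /= ?sq ?sq2//.
- have := E1 i j; have := E2 i j; rewrite !ler_norml => /andP[? ?] /andP[? ?].
  by apply/andP; split; nra.
- by have := l1 i; have := l2 i; nra.
- by have := a1 j; have := a2 j; nra.
Qed.

(** A slack vector with all entries below [s] could be absorbed. The norm slacks cost [s], and the
    matrix part factors through a multiple of the identity at cost at most [s (|I| + 1)]; together
    they spend exactly [g' - g], hence the denominator [|I| + 2]. *)
Lemma feasible_norm g g' v : 0 < g < g' -> ~ approx_balanced M alpha g' -> feasible g v ->
  ((g' - g) / (#|I|%:R + 2)) ^+ 2 <= \sum_x v x ^+ 2.
Proof.
move=> /andP[g0 gg'] nM [K [L [A [E l a]]]]; set s := (g' - g) / _.
rewrite leNgt; apply/negP => lt_s.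
have s0 : 0 < s by rewrite divr_gt0 ?subr_gt0// ltr_wpDl// ler0n.
have vs x : `|v x| <= s.
  have : v x ^+ 2 <= s ^+ 2.
    by apply: le_trans (ltW lt_s); rewrite (bigD1 x)//= lerDl sumr_ge0// => *; exact: sqr_ge0.
  by rewrite -real_normK ?num_real// ler_pXn2r ?nnegrE// ltW.
apply: nM; exists (fun i j => \sum_l L i l * A l j + v (inl (i, j))).
  by move=> i j; have := E i j; congr (`|_| <= _); ring.
have sg : g' = (g + s) + s * (#|I|%:R + 1).
  have : s * (#|I|%:R + 2) = g' - g by rewrite /s divfK// gt_eqF// ltr_wpDl// ler0n.
  by lra.
rewrite sg; apply: balancedD.
  exists K, L, A; split => // [i|j].
    have := l i; have := vs (inr (inl i)); rewrite ler_norml => /andP[? _]; lra.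
  have := a j; have := vs (inr (inr j)); rewrite ler_norml => /andP[? _]; lra.
pose q := Num.sqrt s.
have q0 : 0 < q by rewrite sqrtr_gt0.
have q2 : q ^+ 2 = s by rewrite sqr_sqrtr// ltW.
exists I, (fun i l => q * (i == l)%:R), (fun l j => q^-1 * v (inl (l, j))).
split=> [i j|i|j].
- rewrite (bigD1 i)//= eqxx mulr1 mulVKf ?gt_eqF// big1 ?addr0// => l1.
  by rewrite eq_sym => /negPf ->; rewrite mulr0 mul0r.
- rewrite (bigD1 i)//= eqxx mulr1 q2 big1 ?addr0 => [|l1]; last first.
    by rewrite eq_sym => /negPf ->; rewrite mulr0 expr0n.
  by have := ler0n R #|I|; nra.
- apply: (@le_trans _ _ (\sum_(i : I) s)).
    apply: ler_sum => i _; rewrite exprMn exprVn q2.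
    have := vs (inl (i, j)); rewrite -real_normK ?num_real// => vij.
    by rewrite mulrC ler_pdivrMr// -expr2 ler_pXn2r ?nnegrE// ltW.
  by rewrite sumr_const -mulr_natr; nra.
Qed.

Lemma affine_ge0_slope (C p : R) : (forall l, 0 <= l -> 0 <= C + l * p) -> 0 <= p.
Proof.
move=> h; rewrite leNgt; apply/negP => p0.
have C0 : 0 <= C by have := h 0 (lexx _); rewrite mul0r addr0.
have l0 : 0 <= (C + 1) / - p by rewrite divr_ge0 ?oppr_ge0 ?ltW//; lra.
have lp : (C + 1) / - p * p = - (C + 1) by field; rewrite lt_eqF.
by have := h _ l0; rewrite lp; lra.
Qed.

(** [U] is the matrix part of a functional separating [feasible g] from 0, while [P] and [Q] are
    minus its parts on the norm slacks. Each conclusion comes from testing the functional on a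
    special feasible point, three of them along a ray sent to infinity. *)
Lemma gamma2_dual g g' : 0 < g < g' -> ~ approx_balanced M alpha g' ->
  exists (U : I -> J -> R) (P : I -> R) (Q : J -> R),
    [/\ forall i, 0 <= P i, forall j, 0 <= Q j,
        forall a b, \sum_i \sum_j U i j * (a i * b j) <=
          \sum_i P i * a i ^+ 2 + \sum_j Q j * b j ^+ 2 &
        g * (\sum_i P i + \sum_j Q j) + alpha * \sum_i \sum_j `|U i j| <
          \sum_i \sum_j U i j * M i j].
Proof.
move=> gg' nM.
have g0 : 0 < g by case/andP: gg'.
pose s := (g' - g) / (#|I|%:R + 2).
have s0 : 0 < s ^+ 2.
  rewrite exprn_gt0// divr_gt0 ?subr_gt0 ?ltr_wpDl ?ler0n//; first by case/andP: gg'.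
have [||u v t|v fv|c cP] := @separation_from_0_fun R _ (feasible g) (s ^+ 2).
- exists (fun x => match x with inl p => M p.1 p.2 | inr _ => g end).
  exists void, (fun _ _ => 0), (fun _ _ => 0).
  by split=> *; rewrite big_pred0 ?subr0 ?subrr ?normr0//; case.
- exact: s0.
- exact: feasible_convex.
- exact: (feasible_norm gg').
pose U i j := c (inl (i, j)).
pose P i := - c (inr (inl i)).
pose Q j := - c (inr (inr j)).
have cS v : \sum_x c x * v x = \sum_i \sum_j U i j * v (inl (i, j))
    - \sum_i P i * v (inr (inl i)) - \sum_j Q j * v (inr (inr j)).
  rewrite big_sumType /= big_sumType /= -addrA; congr (_ + _).
    by rewrite pair_big /=; apply: eq_bigr => -[].
  rewrite -!sumrN; congr (_ + _); apply: eq_bigr => x _; rewrite /P /Q; ring.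
(* The free parameters of a feasible point are the factorization, an entrywise error [V], and losses
   [S], [T] that lower the slacks. *)
have main (K : finType) (L : I -> K -> R) (A : K -> J -> R) V S T :
    (forall i j, `|V i j| <= alpha) -> (forall i, 0 <= S i) -> (forall j, 0 <= T j) ->
    0 < \sum_i \sum_j U i j * (M i j - \sum_l L i l * A l j + V i j)
      - \sum_i P i * (g - \sum_l L i l ^+ 2 - S i)
      - \sum_j Q j * (g - \sum_l A l j ^+ 2 - T j).
  move=> Va S0 T0.
  pose v x := match x with
    | inl p => M p.1 p.2 - \sum_l L p.1 l * A l p.2 + V p.1 p.2
    | inr (inl i) => g - \sum_l L i l ^+ 2 - S i
    | inr (inr j) => g - \sum_l A l j ^+ 2 - T j end.
  have /cP : feasible g v.
    exists K, L, A; split=> [i j|i|j] /=.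
    - by rewrite addrC addKr.
    - by rewrite lerBlDr lerDl.
    - by rewrite lerBlDr lerDl.
  by move=> /(lt_le_trans s0); rewrite cS.
pose C := \sum_i \sum_j U i j * M i j - \sum_i P i * g - \sum_j Q j * g.
(* With the empty factorization, an arbitrarily large loss at the single row [i0] forces the sign of
   [P i0]; columns are treated likewise. *)
have P0 i0 : 0 <= P i0.
  apply: (@affine_ge0_slope C) => l l0; apply: ltW.
  have := main void (fun _ _ => 0) (fun _ _ => 0) (fun _ _ => 0)
    (fun i => l * (i == i0)%:R) (fun=> 0).
  rewrite normr0 => /(_ (fun _ _ => alpha0) _ (fun _ => lexx _)) h.
  have {}h := h (fun i => mulr_ge0 l0 (ler0n _ _)); apply: (lt_le_trans h).
  rewrite le_eqVlt; apply/orP; left; apply/eqP.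
  under eq_bigr do under eq_bigr do rewrite big_pred0 ?subr0 ?addr0//.
  under [X in _ - X - _]eq_bigr => i _.
    rewrite big_pred0; last by case.
    rewrite subr0 mulrBr.
    over.
  rewrite sumrB [X in _ - (_ - X)](bigD1 i0)//= eqxx mulr1.
  rewrite [X in _ - (_ - (_ + X))]big1 ?addr0; last first.
    by move=> i /negPf ->; rewrite !mulr0.
  under [X in _ - X = _]eq_bigr do rewrite big_pred0 ?subr0//.
  rewrite /C; ring.
have Q0 j0 : 0 <= Q j0.
  apply: (@affine_ge0_slope C) => l l0; apply: ltW.
  have := main void (fun _ _ => 0) (fun _ _ => 0) (fun _ _ => 0)
    (fun=> 0) (fun i => l * (i == j0)%:R).
  rewrite normr0 => /(_ (fun _ _ => alpha0) (fun _ => lexx _)) h.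
  have {}h := h (fun i => mulr_ge0 l0 (ler0n _ _)); apply: (lt_le_trans h).
  rewrite le_eqVlt; apply/orP; left; apply/eqP.
  under eq_bigr do under eq_bigr do rewrite big_pred0 ?subr0 ?addr0//.
  under [X in _ - X = _]eq_bigr => i _.
    rewrite big_pred0; last by case.
    rewrite subr0 mulrBr.
    over.
  rewrite sumrB [X in _ - (_ - X)](bigD1 j0)//= eqxx mulr1.
  rewrite [X in _ - (_ - (_ + X))]big1 ?addr0; last first.
    by move=> i /negPf ->; rewrite !mulr0.
  under [X in _ - X - _]eq_bigr do rewrite big_pred0 ?subr0//.
  rewrite /C; ring.
exists U, P, Q; split => // [a b|].
  (* The rank-one factorization with factors [sqrt l a] and [sqrt l b] gives an expression affine in
     [l], whose slope is the desired difference. *)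
  rewrite -subr_ge0; apply: (@affine_ge0_slope C) => l l0; apply: ltW.
  have := main unit (fun i _ => Num.sqrt l * a i) (fun _ j => Num.sqrt l * b j)
    (fun _ _ => 0) (fun=> 0) (fun=> 0).
  rewrite normr0 => /(_ (fun _ _ => alpha0) (fun _ => lexx _) (fun _ => lexx _)) h.
  apply: (lt_le_trans h); rewrite le_eqVlt; apply/orP; left; apply/eqP.
  have sl : Num.sqrt l ^+ 2 = l by rewrite sqr_sqrtr.
  rewrite (_ : \sum_i _ = \sum_i \sum_j U i j * M i j - l * \sum_i \sum_j U i j * (a i * b j)).
    rewrite (_ : \sum_i P i * _ = \sum_i P i * g - l * \sum_i P i * a i ^+ 2).
      rewrite (_ : \sum_j Q j * _ = \sum_j Q j * g - l * \sum_j Q j * b j ^+ 2).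
        rewrite /C; ring.
      rewrite mulr_sumr -sumrB; apply: eq_bigr => j _.
      by rewrite big_const /= card_unit /= addr0 exprMn sl; ring.
    rewrite mulr_sumr -sumrB; apply: eq_bigr => i _.
    by rewrite big_const /= card_unit /= addr0 exprMn sl; ring.
  rewrite mulr_sumr -sumrB; apply: eq_bigr => i _.
  rewrite mulr_sumr -sumrB; apply: eq_bigr => j _.
  by rewrite big_const /= card_unit /= addr0 mulrACA -expr2 sl; ring.
(* The worst admissible error opposes the sign of [U] everywhere and costs [alpha] times the
   entrywise l1 norm of [U]. *)
have := main void (fun _ _ => 0) (fun _ _ => 0) (fun i j => - (alpha * Num.sg (U i j)))
    (fun=> 0) (fun=> 0).
have h1 i j : `|- (alpha * Num.sg (U i j))| <= alpha.
  rewrite normrN normrM normr_sg ger0_norm//.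
  by case: (U i j != 0); rewrite ?mulr1 ?mulr0.
move=> /(_ h1 (fun _ => lexx _) (fun _ => lexx _)) h; rewrite -subr_gt0.
apply: (lt_le_trans h); rewrite le_eqVlt; apply/orP; left; apply/eqP.
have void0 (f : void -> R) : \sum_l f l = 0 by rewrite big_pred0//; case.
under eq_bigr do under eq_bigr do rewrite void0 subr0 mulrDr mulrN mulrCA [U _ _ * Num.sg _]mulrC -normrEsg.
under eq_bigr do rewrite big_split /= sumrN -mulr_sumr.
rewrite big_split /= sumrN -mulr_sumr /=.
under [X in _ - X - _]eq_bigr do rewrite big_pred0 ?subr0//.
under [X in _ - X = _]eq_bigr do rewrite big_pred0 ?subr0//.
rewrite -!mulr_suml; ring.
Qed.

End Duality.

(** * A hard family of perturbations from the dual certificate *)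

Section HardFamily.
Context {R : realType} (I J : finType) (M : I -> J -> R) (alpha : R).

(* The dual certificate (U, P, Q) is turned into a weighted family: for the rows i whose correlation
   r_i with M exceeds alpha |U_i|_1, the signed measure alpha U_i / r_i gets weight
   proportional to r_i^2 / P_i. *)
Lemma hard_family g g' : 0 <= alpha -> 0 < g < g' -> ~ approx_balanced M alpha g' ->
  exists (w : I -> R) (p mu : I -> J -> R),
    [/\ forall i, 0 <= w i, \sum_i w i = 1,
        forall i, 0 < w i -> [/\ forall j, `|mu i j| <= p i j, \sum_j p i j = 1 &
          \sum_j M i j * mu i j = alpha] &
        forall h, (forall j, `|h j| <= 1) ->
          \sum_i w i * (\sum_j mu i j * h j) ^+ 2 <= (alpha / g) ^+ 2].
Proof.
move=> alpha0 gg' nM.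
have g0 : 0 < g by case/andP: gg'.
have [U [P [Q [P0 Q0 UPQ gap]]]] := gamma2_dual alpha0 gg' nM.
pose pi i := \sum_j `|U i j|.
pose r i := \sum_j U i j * M i j.
pose G := [pred i | alpha * pi i < r i].
set Ps := \sum_i P i in gap; set Qs := \sum_j Q j in gap.
have Ps0 : 0 <= Ps by exact: sumr_ge0.
have Qs0 : 0 <= Qs by exact: sumr_ge0.
have pi0 i : 0 <= pi i by exact: sumr_ge0.
have r_gt0 i : G i -> 0 < r i by apply: le_lt_trans; exact: mulr_ge0.
have sq_sum (h : J -> R) : (forall j, `|h j| <= 1) -> \sum_j Q j * h j ^+ 2 <= Qs.
  move=> h1; apply: ler_sum => j _; rewrite -[leRHS]mulr1; apply: ler_wpM2l => //.
  by rewrite -real_normK ?num_real// expr_le1// h1.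
pose Uh h i := \sum_j U i j * h j.
have UPQ' (h : J -> R) (a : I -> R) : (forall j, `|h j| <= 1) ->
    \sum_i a i * Uh h i <= \sum_i P i * a i ^+ 2 + Qs.
  move=> h1; apply: (@le_trans _ _ (\sum_i P i * a i ^+ 2 + \sum_j Q j * h j ^+ 2)).
    apply: le_trans (UPQ a h); apply: ler_sum => i _; rewrite /Uh mulr_sumr.
    by apply: ler_sum => j _; rewrite mulrCA.
  by rewrite lerD2l; exact: sq_sum.
have sg1 i j : `|Num.sg (U i j)| <= 1 by rewrite normr_sg; case: (_ != _).
have Usg i : Uh (fun j => Num.sg (U i j)) i = pi i.
  by apply: eq_bigr => j _; rewrite mulrC -normrEsg.
have pi_gt0 i : G i -> 0 < pi i.
  move=> Gi; rewrite lt_neqAle pi0 andbT eq_sym; apply/negP => /eqP pz.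
  have U0 j : U i j = 0.
    apply/eqP; rewrite -normr_le0 -pz /pi (bigD1 j)//= lerDl; exact: sumr_ge0.
  by have := r_gt0 i Gi; rewrite /r big1 ?ltxx// => j _; rewrite U0 mul0r.
(* If [P i = 0], the multiplier at row [i] is unpenalised; with [h] the sign pattern of that row, it
   can be chosen to give [Qs + 1 <= Qs]. *)
have P_gt0 i : G i -> 0 < P i.
  move=> Gi; rewrite lt_neqAle P0 andbT eq_sym; apply/negP => /eqP Pz.
  have := UPQ' _ (fun k => (k == i)%:R * ((Qs + 1) / pi i)) (sg1 i).
  rewrite (bigD1 i)//= eqxx mul1r Usg divfK ?gt_eqF ?pi_gt0// big1 ?addr0; last first.
    by move=> k /negPf ->; rewrite !mul0r.
  rewrite big1 => [|k _]; last first.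
    by have [->|] := eqVneq k i; rewrite ?Pz ?mul0r// expr0n mulr0.
  lra.
pose N := \sum_(i | G i) r i ^+ 2 / P i.
(* Rows outside [G] have [r i <= alpha * pi i], so the penalty term of the gap pays for dropping
   them. *)
have rho : g * (Ps + Qs) < \sum_(i | G i) r i.
  rewrite -(ltrD2r (alpha * \sum_i pi i)); apply: (lt_le_trans gap).
  rewrite mulr_sumr -[leLHS]/(\sum_i r i) (bigID G)/= lerD2l [leRHS](bigID G)/=.
  apply: ler_wpDl; first by apply: sumr_ge0 => i _; exact: mulr_ge0.
  by apply: ler_sum => i; rewrite -leNgt.
have grho0 : 0 <= g * (Ps + Qs) by apply: mulr_ge0; [exact: ltW|exact: addr_ge0].
have rhoN : (\sum_(i | G i) r i) ^+ 2 <= Ps * N.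
  apply: quadratic_sq_le => // l; rewrite /N mulr_sumr.
  apply: (@le_trans _ _ (\sum_(i | G i) (l ^+ 2 * P i + r i ^+ 2 / P i))).
    apply: ler_sum => i Gi; have Pi := P_gt0 i Gi.
    rewrite -subr_ge0 (_ : _ - _ = (l * P i - r i) ^+ 2 / P i); last by field; rewrite gt_eqF.
    by rewrite divr_ge0 ?sqr_ge0.
  rewrite big_split /= -mulr_sumr lerD2r; apply: ler_wpM2l; first exact: sqr_ge0.
  by rewrite /Ps [leRHS](bigID G)/= lerDl sumr_ge0.
have rho0 : 0 < \sum_(i | G i) r i by exact: le_lt_trans rho.
have N0 : 0 < N.
  have N_ge0 : 0 <= N by apply: sumr_ge0 => i Gi; rewrite divr_ge0 ?sqr_ge0.
  rewrite lt_neqAle N_ge0 andbT eq_sym; apply/negP => /eqP Nz.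
  by move: rhoN; rewrite Nz mulr0 leNgt exprn_gt0.
have Ps_gt0 : 0 < Ps.
  rewrite lt_neqAle Ps0 andbT eq_sym; apply/negP => /eqP Pz.
  by move: rhoN; rewrite Pz mul0r leNgt exprn_gt0.
(* Combines [4 Ps Qs <= (Ps + Qs)^2] with the Cauchy-Schwarz bound [rhoN] and cancels [Ps]. *)
have NQ : 4 * Qs * g ^+ 2 <= N.
  rewrite -(ler_pM2l Ps_gt0); apply: le_trans rhoN.
  apply: (@le_trans _ _ ((g * (Ps + Qs)) ^+ 2)).
    rewrite -subr_ge0 (_ : _ - _ = (g * (Ps - Qs)) ^+ 2); last by ring.
    exact: sqr_ge0.
  by rewrite ler_pXn2r ?nnegrE// ltW.
(* The multiplier [Uh h i / (2 P i)] optimises the quadratic form inequality row by row. *)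
have UhP h : (forall j, `|h j| <= 1) -> \sum_(i | G i) Uh h i ^+ 2 / P i <= 4 * Qs.
  move=> h1; have := UPQ' h (fun i => if G i then Uh h i / (2 * P i) else 0) h1.
  have -> : \sum_i (if G i then Uh h i / (2 * P i) else 0) * Uh h i =
      2^-1 * \sum_(i | G i) Uh h i ^+ 2 / P i.
    rewrite (bigID G)/= [X in _ + X]big1 ?addr0; last first.
      by move=> i /negPf ->; rewrite mul0r.
    rewrite mulr_sumr; apply: eq_bigr => i Gi; rewrite (_ : (_ < _) = true)//.
    by field; rewrite gt_eqF ?P_gt0.
  have -> : \sum_i P i * (if G i then Uh h i / (2 * P i) else 0) ^+ 2 =
      4^-1 * \sum_(i | G i) Uh h i ^+ 2 / P i.
    rewrite (bigID G)/= [X in _ + X]big1 ?addr0; last first.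
      by move=> i /negPf ->; rewrite expr0n mulr0.
    rewrite mulr_sumr; apply: eq_bigr => i Gi; rewrite (_ : (_ < _) = true)//.
    by field; rewrite gt_eqF ?P_gt0.
  lra.
(* The point law is the normalised [|U i j|]; the condition [alpha * pi i < r i] defining [G]
   ensures [|mu| <= p]. *)
exists (fun i => if G i then r i ^+ 2 / P i / N else 0),
  (fun i j => `|U i j| / pi i), (fun i j => alpha * U i j / r i).
split=> [i||i|h h1].
- by case: ifP => // Gi; rewrite divr_ge0 ?divr_ge0 ?sqr_ge0// ltW.
- by rewrite -big_mkcond -mulr_suml divff// gt_eqF.
- case: ifP => [Gi _|_]; last by rewrite ltxx.
  have ri := r_gt0 _ Gi; have pii := pi_gt0 _ Gi.
  split=> [j||].
  + rewrite normrM normrM normfV (ger0_norm alpha0) (gtr0_norm ri).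
    rewrite ler_pdivrMr// mulrAC ler_pdivlMr// -mulrA mulrCA.
    by apply: ler_wpM2l => //; exact: ltW.
  + by rewrite -mulr_suml divff// gt_eqF.
  + transitivity (\sum_j (alpha / r i) * (U i j * M i j)).
      by apply: eq_bigr => j _; ring.
    by rewrite -mulr_sumr divfK// gt_eqF.
- apply: (@le_trans _ _ (\sum_(i | G i) (alpha ^+ 2 / N) * (Uh h i ^+ 2 / P i))).
    rewrite le_eqVlt; apply/orP; left; apply/eqP; rewrite [RHS]big_mkcond /=.
    apply: eq_bigr => i _; case: ifP => Gi; last by rewrite mul0r.
    have -> : \sum_j alpha * U i j / r i * h j = alpha / r i * Uh h i.
      by rewrite /Uh mulr_sumr; apply: eq_bigr => j _; ring.
    by field; rewrite !gt_eqF ?P_gt0 ?r_gt0.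
  rewrite -mulr_sumr; apply: (@le_trans _ _ (alpha ^+ 2 / N * (4 * Qs))).
    by apply: ler_wpM2l (UhP h h1); rewrite divr_ge0 ?sqr_ge0 ?ltW.
  rewrite expr_div_n -mulrA; apply: ler_wpM2l; first exact: sqr_ge0.
  by rewrite mulrC ler_pdivrMr// [leRHS]mulrC ler_pdivlMr ?exprn_gt0.
Qed.

End HardFamily.

(** * Lower bound *)

Section LowerBound.
Context {R : realType}.

Lemma loss_biased (X : finType) (p mu : X -> R) (h : X -> bool) :
  \sum_x p x = 1 -> loss (biased p mu) h = 2^-1 - 2^-1 * \sum_x pm (h x) * mu x.
Proof.
move=> p1; rewrite /loss big_mkcond sum_pair_bool.
rewrite -[X in _ = X - _]mulr1 -[X in _ = _ * X - _]p1 -mulrBr -sumrB mulr_sumr.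
by apply: eq_bigr => x _; rewrite /biased /pm; case: (h x) => /=; field.
Qed.

(** Every hard pair needs total chi-square at least [c0^2], while averaging over the family with
    weights [w] bounds the contribution of each user. The sign [s] is harmless because the
    divergence depends on the square of [mu]. The constant 16 combines the 4 of the chi-square bound
    with the square of [2 eps]. *)
Lemma chi_square_family d (O : measurableType d) (X I : finType) n
    (Q : 'I_n -> X * bool -> probability O R) (M : I -> X -> R)
    (eps alpha c0 g g' : R) :
  0 < eps <= 1 -> 0 <= alpha -> (forall i, eps_LDP eps (Q i)) ->
  0 < g < g' -> ~ approx_balanced M alpha g' ->
  (forall i (p mu : X -> R), (forall x, `|mu x| <= p x) -> \sum_x p x = 1 ->
     \sum_x M i x * mu x = alpha ->
     exists (s : R) (F : seq O -> R), [/\ s ^+ 2 = 1, bms n F, forall os, 0 <= F os <= 1 &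
       c0 ^+ 2 <= (pexp Q (biased p (fun x => s * mu x)) F -
                   pexp Q (biased p (fun=> 0)) F) ^+ 2]) ->
  c0 ^+ 2 <= n%:R * (16 * eps ^+ 2 * (alpha / g) ^+ 2).
Proof.
move=> /andP[eps0 eps1] alpha0 ldp gg' nM test.
have [w [p [mu [w0 w1 wP wh]]]] := hard_family alpha0 gg' nM.
have [i0 wi0] : exists i, 0 < w i.
  apply/not_existsP => wn; have := w1; rewrite big1; last first.
    by move=> i _; apply/eqP; rewrite eq_le w0 andbT leNgt; apply/negP/wn.
  by move/eqP; rewrite eq_sym oner_eq0.
have [x0 _] : exists x : X, True.
  apply/not_existsP => Xn; have [_ + _] := wP _ wi0.
  rewrite big1; first by move/eqP; rewrite eq_sym oner_eq0.
  by move=> x; case: (Xn x).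
have eps01 : 0 <= eps <= 1 by rewrite ltW.
have /choice[m /choice[h hP]] := fun i => ldp_chi_square x0 eps01 (ldp i).
have bh i x : bmf (h i x) by have [mh hb _] := hP i; split => //; exists (2 * eps).
pose v i k o := \sum_x mu k x * h i x o.
have bv i k : bmf (v i k) by apply: bmf_sum => x _; exact: bmfZ.
pose S k i := 4 * \int[m i]_o v i k o ^+ 2.
have S0 k i : 0 <= S k i by rewrite mulr_ge0// Rintegral_ge0// => o _; exact: sqr_ge0.
have lb k : 0 < w k -> c0 ^+ 2 <= \sum_i S k i.
  move=> wk; have [mup p1 Mmu] := wP k wk.
  have [s [F [s2 bF F01 /le_trans]]] := test k (p k) (mu k) mup p1 Mmu; apply.
  have s1 : `|s| = 1 by apply/eqP; rewrite -sqr_norm_eq1 s2.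
  have smup x : `|s * mu k x| <= p k x by rewrite normrM s1 mul1r.
  have dp : is_dist (biased (p k) (fun=> 0)).
    by apply: biased_dist => // x; rewrite normr0 (le_trans _ (mup x)).
  apply: pexp_sub_sq_le => // [|i g0 bg0]; first exact: biased_dist.
  have [_ _ /(_ _ _ _ smup p1 bg0)] := hP i.
  rewrite (_ : \int[m i]_o _ = \int[m i]_o v i k o ^+ 2)//.
  apply: eq_Rintegral => o _; rewrite -[RHS]mul1r -s2 -exprMn; congr (_ ^+ 2).
  by rewrite /v mulr_sumr; apply: eq_bigr => x _; rewrite mulrA.
apply: (@le_trans _ _ (\sum_k w k * \sum_i S k i)).
  rewrite -[leLHS]mul1r -w1 mulr_suml; apply: ler_sum => k _.
  have := w0 k; rewrite le_eqVlt => /predU1P[<-|wk]; first by rewrite !mul0r.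
  by apply: ler_wpM2l => //; exact: lb.
under eq_bigr do rewrite mulr_sumr.
rewrite exchange_big /= -[n in n%:R]card_ord -sumr_const mulr_suml.
apply: ler_sum => i _.
have bwv k : bmf (fun o => w k * v i k o ^+ 2) by apply: bmfZ; exact: bmfX2.
rewrite (_ : \sum_k w k * S k i = 4 * \int[m i]_o \sum_k w k * v i k o ^+ 2); last first.
  rewrite bexp_sum// mulr_sumr; apply: eq_bigr => k _.
  by rewrite bexpZ; [rewrite /S; ring|exact: bmfX2].
rewrite mul1r (_ : 16 * _ * _ = 4 * (4 * (eps ^+ 2 * (alpha / g) ^+ 2))); last by ring.
apply: ler_wpM2l => //.
rewrite -[leRHS](bexp_cst (m i)); apply: le_bexp; [exact: bmf_sum|exact: bmf_cst|move=> o].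
have e2 : 0 < 2 * eps by rewrite mulr_gt0.
(* For each fixed report [o], the rescaled [h] is an admissible test function for the hard family,
   uniformly over its rows. *)
have hb x : `|h i x o / (2 * eps)| <= 1.
  by have [_ /(_ x o) hb _] := hP i; rewrite normrM normfV (gtr0_norm e2) ler_pdivrMr// mul1r.
have := wh _ hb; rewrite -(ler_pM2l (exprn_gt0 2 e2)).
rewrite (_ : (2 * eps) ^+ 2 * (alpha / g) ^+ 2 = 4 * (eps ^+ 2 * (alpha / g) ^+ 2)); last by ring.
move=> hk.
apply: le_trans hk; rewrite mulr_sumr le_eqVlt; apply/orP; left; apply/eqP.
apply: eq_bigr => k _.
have -> : \sum_j mu k j * (h i j o / (2 * eps)) = v i k o / (2 * eps).
  by rewrite /v mulr_suml; apply: eq_bigr => x _; rewrite mulrA.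
by field; rewrite gt_eqF.
Qed.

End LowerBound.

(** * Testing by learners and refuters *)

Section LearningLowerBound.
Context {R : realType}.

Lemma pm_sqr (b : bool) : (pm b : R) ^+ 2 = 1.
Proof. by case: b; rewrite /pm ?expr1n ?sqrrN ?expr1n. Qed.

(** A matrix with identical sign rows is rank one of cost 1, which is the source of the [- 1] in the
    lower bound. *)
Lemma approx_balanced_shift (I J : finType) (W : I -> J -> R) (v : J -> bool) alpha r :
  approx_balanced (fun i j => W i j - pm (v j)) alpha r -> approx_balanced W alpha (r + 1).
Proof.
move=> [Mt Mta gMt]; exists (fun i j => Mt i j + pm (v j)).
  by move=> i j; have := Mta i j; congr (`|_| <= _); ring.
apply: balancedD => //; exists unit, (fun _ _ => 1), (fun _ j => pm (v j)).
by split=> [i j|i|j]; rewrite big_const /= card_unit /= addr0 ?mul1r ?expr1n ?pm_sqr.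
Qed.

Lemma gamma2_shift_le (I J : finType) (W : I -> J -> R) (v : J -> bool)
    (alpha eps c0 : R) n :
  0 < alpha -> 0 < eps -> 0 < c0 ->
  (forall g g' : R, 0 < g < g' -> ~ approx_balanced (fun i j => W i j - pm (v j)) alpha g' ->
     c0 ^+ 2 <= n%:R * (16 * eps ^+ 2 * (alpha / g) ^+ 2)) ->
  c0 ^+ 2 / 16 * (Num.max 0 (gamma2_approx W alpha - 1)) ^+ 2 / (eps ^+ 2 * alpha ^+ 2)
    <= n%:R.
Proof.
move=> alpha0 eps0 c00 H; set G := gamma2_approx W alpha.
have [G1|G1] := leP (G - 1) 0.
  by rewrite expr0n mulr0 mul0r ler0n.
rewrite ler_pdivrMr ?mulr_gt0 ?exprn_gt0//.
pose B := 4 * eps * alpha * Num.sqrt n%:R / c0.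
have B0 : 0 <= B by rewrite !mulr_ge0 ?invr_ge0 ?sqrtr_ge0// ltW.
have B2 : (c0 * B) ^+ 2 = 16 * n%:R * (eps ^+ 2 * alpha ^+ 2).
  rewrite (_ : c0 * B = 4 * eps * alpha * Num.sqrt n%:R); last first.
    by rewrite /B mulrC divfK// gt_eqF.
  by rewrite !exprMn sqr_sqrtr ?ler0n//; ring.
have GB : G - 1 <= B.
  rewrite leNgt; apply/negP => BG.
  (* [B] is where the assumed inequality becomes an equality, so any [g] strictly between [B] and
     [G - 1] contradicts it; [g'] leaves room below [G - 1]. *)
  pose g := (B + (G - 1)) / 2; pose g' := (g + (G - 1)) / 2.
  have gB : B < g by rewrite /g; lra.
  have gG : g < G - 1 by rewrite /g; lra.
  have g0 : 0 < g by exact: le_lt_trans gB.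
  have gg' : 0 < g < g' by rewrite g0 /g'; lra.
  have nM : ~ approx_balanced (fun i j => W i j - pm (v j)) alpha g'.
    move=> /approx_balanced_shift h.
    have g'1 : 0 <= g' + 1 by case/andP: gg'; lra.
    by have := gamma2_approx_le g'1 h; rewrite -/G /g'; lra.
  have := H _ _ gg' nM.
  rewrite (_ : n%:R * _ = (c0 * B) ^+ 2 / g ^+ 2); last first.
    by rewrite B2; field; rewrite gt_eqF.
  rewrite ler_pdivlMr ?exprn_gt0//.
  move=> h; have : (c0 * g) ^+ 2 <= (c0 * B) ^+ 2 by rewrite exprMn.
  have cg : 0 <= c0 * g by apply: mulr_ge0; exact: ltW.
  have cB : 0 <= c0 * B by apply: mulr_ge0 => //; exact: ltW.
  by rewrite ler_pXn2r ?nnegrE// ler_pM2l// leNgt gB.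
have : c0 ^+ 2 * (G - 1) ^+ 2 <= (c0 * B) ^+ 2.
  have cG : 0 <= c0 * (G - 1) by apply: mulr_ge0; exact: ltW.
  have cB : 0 <= c0 * B by apply: mulr_ge0 => //; exact: ltW.
  by rewrite -exprMn ler_pXn2r ?nnegrE// ler_pM2l.
rewrite B2; lra.
Qed.

Section Tests.
Context d (O : measurableType d) (X : finType) (n : nat).
Variables (Q : 'I_n -> X * bool -> probability O R).

Lemma decoder_bms (H : finType) (Dec : seq O -> H -> R) (G : pred H) :
  is_decoder n Dec -> bms n (fun os => \sum_(h | G h) Dec os h).
Proof.
move=> [D0 [D1 mD]]; apply: (bmf_sum (T := n.-tuple O)) => h _; split=> //.
exists 1 => t; rewrite ger0_norm// -(D1 (tval t)) (bigD1 h)//= lerDl sumr_ge0//.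
Qed.

Lemma decoder_01 (H : finType) (Dec : seq O -> H -> R) (G : pred H) os :
  is_decoder n Dec -> 0 <= \sum_(h | G h) Dec os h <= 1.
Proof.
move=> [D0 [D1 mD]]; rewrite sumr_ge0//= -(D1 os) [leRHS](bigID G)/= lerDl.
exact: sumr_ge0.
Qed.

Lemma pexp_decoder_sub (H : finType) (Dec : seq O -> H -> R) (G G' : pred H) D :
  is_decoder n Dec -> is_dist D -> (forall h, G h -> G' h) ->
  pexp Q D (fun os => \sum_(h | G h) Dec os h) <=
  pexp Q D (fun os => \sum_(h | G' h) Dec os h).
Proof.
move=> dDec dD GG'; apply: le_pexp => // [||os _]; [exact: decoder_bms..|].
have [D0 [D1 mD]] := dDec.
rewrite big_mkcond [leRHS]big_mkcond; apply: ler_sum => h _.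
by case: ifP => [/GG' ->//|_]; case: ifP.
Qed.

Lemma pexp_decoderC (H : finType) (Dec : seq O -> H -> R) (G : pred H) D :
  is_decoder n Dec -> is_dist D ->
  pexp Q D (fun os => \sum_(h | G h) Dec os h) =
  1 - pexp Q D (fun os => \sum_(h | ~~ G h) Dec os h).
Proof.
move=> dDec dD; apply/eqP; rewrite eq_sym subr_eq eq_sym -pexpD; [|exact: decoder_bms..].
rewrite (_ : (fun os => _) = fun=> 1) ?pexp_cst//; apply/funext => os.
by have [_ [D1 _]] := dDec; rewrite -(D1 os) [RHS](bigID G).
Qed.

End Tests.

Lemma sqr_test (c0 a b : R) : 0 < c0 -> c0 <= a - b -> c0 ^+ 2 <= (a - b) ^+ 2.
Proof. by move=> c00 h; rewrite ler_pXn2r ?nnegrE// ?ltW// (lt_le_trans c00). Qed.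

Theorem learning_lower_bound (X : finType) (C : {set {ffun X -> bool}})
    (eps alpha c0 beta : R) (n : nat) :
  0 < eps <= 1 -> 0 < alpha -> 0 < c0 -> beta <= 2^-1 - c0 ->
  ldp_learnable C eps (alpha / 8) beta n \/ ldp_refutable C eps (alpha / 8) beta n ->
  c0 ^+ 2 / 16 * (Num.max 0 (gamma2_approx (concept_matrix C) alpha - 1)) ^+ 2
    / (eps ^+ 2 * alpha ^+ 2) <= n%:R.
Proof.
move=> eps01 alpha0 c00 betac0 lr.
have eps0 : 0 < eps by case/andP: eps01.
(* For the empty class the matrix has no rows, its approximate norm is at most 0, and the claimed
   bound is 0. *)
have [C0|[cs csC]] := set_0Vmem C.
  rewrite max_l ?expr0n ?mulr0 ?mul0r//.
  rewrite subr_le0; apply: (le_trans _ ler01); apply: gamma2_approx_le => //.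
  have noC (c : {c | c \in C}) : False by case: c => c cC; rewrite C0 inE in cC.
  exists (concept_matrix C); first by move=> c; case: (noC c).
  exists void, (fun _ _ => 0), (fun _ _ => 0).
  by split=> [c|c|j]; [case: (noC c)..|rewrite big_pred0//; case].
apply: (@gamma2_shift_le _ _ _ (cs : X -> bool)) => // g g' gg' nM.
have symm (p mu : X -> R) (s : R) : s ^+ 2 = 1 -> (forall x, `|mu x| <= p x) ->
    \sum_x p x = 1 -> is_dist (biased p (fun x => s * mu x)).
  move=> s2 mup p1; apply: biased_dist => // x; rewrite normrM.
  have -> : `|s| = 1 by apply/eqP; rewrite -sqr_norm_eq1 s2.
  by rewrite mul1r.
have null (p mu : X -> R) : (forall x, `|mu x| <= p x) -> \sum_x p x = 1 ->
    is_dist (biased p (fun=> 0 : R)).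
  by move=> mup p1; apply: biased_dist => // x; rewrite normr0 (le_trans _ (mup x)).
have sumZ (h : X -> bool) (mu : X -> R) s :
    \sum_x pm (h x) * (s * mu x) = s * \sum_x pm (h x) * mu x.
  by rewrite mulr_sumr; apply: eq_bigr => x _; rewrite mulrCA.
have split_corr (c : {c | c \in C}) (mu : X -> R) :
    \sum_x (concept_matrix C c x - pm (cs x)) * mu x =
    \sum_x pm (sval c x) * mu x - \sum_x pm (cs x) * mu x.
  by rewrite -sumrB; apply: eq_bigr => x _; rewrite mulrBl.
have one2 : (1 : R) ^+ 2 = 1 by rewrite expr1n.
have mone2 : (-1 : R) ^+ 2 = 1 by rewrite sqrrN expr1n.
case: lr => -[d [T [Q [Dec [[ldp dDec] H]]]]].
  apply: (chi_square_family eps01 (ltW alpha0) ldp gg' nM) => c p mu mup p1.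
  rewrite split_corr => cor.
  pose Dp := biased p (fun x => 1 * mu x); pose Dm := biased p (fun x => (-1) * mu x).
  have dDp : is_dist Dp by exact: symm.
  have dDm : is_dist Dm by exact: symm.
  (* Under [Dp], passing this test means correlation with [mu] at least that of [cs] plus
     [3 alpha / 4]. Under [Dm], competing with [cs] means at most that of [cs] plus [alpha / 4], so
     a successful output fails the test. *)
  pose G (h : {ffun X -> bool}) := loss Dp h <= loss Dp (sval c) + alpha / 8.
  pose F (os : seq T) := \sum_(h | G h) Dec os h.
  have Fp : 1 - beta <= pexp Q Dp F.
    have := H Dp dDp; rewrite succ_probE// lee_fin => /le_trans; apply.
    apply: pexp_decoder_sub => // h /forall_inP; apply; exact: valP.
  have Fm : pexp Q Dm F <= beta.
    rewrite /F pexp_decoderC// lerBlDr -lerBlDl.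
    have := H Dm dDm; rewrite succ_probE// lee_fin => /le_trans; apply.
    apply: pexp_decoder_sub => // h /forall_inP /(_ _ csC).
    rewrite /G /Dm /Dp !loss_biased// !sumZ -ltNge => hm.
    lra.
  pose F0 := pexp Q (biased p (fun=> 0)) F.
  (* The acceptance probabilities under [Dp] and [Dm] differ by at least [1 - 2 beta >= 2 c0], so
     one of them is [c0] away from the fair-label value. *)
  have [h|h] := leP c0 (pexp Q Dp F - F0).
    exists 1, F; split => //; [exact: decoder_bms dDec|by move=> os; exact: (decoder_01 _ os dDec)|].
    exact: sqr_test.
  exists (-1), F; split => //; [exact: decoder_bms dDec|by move=> os; exact: (decoder_01 _ os dDec)|].
  rewrite -[leRHS]sqrrN opprB; apply: sqr_test => //; rewrite -/F0 -/Dm; lra.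
apply: (chi_square_family eps01 (ltW alpha0) ldp gg' nM) => c p mu mup p1.
rewrite split_corr => cor.
(* The correlations of [c] and [cs] with [mu] differ by [alpha], so either [c] has at least
   [alpha / 2] with [mu], or [cs] has more than that with [- mu]. The resulting advantage
   [alpha / 4] over random labels exceeds [alpha / 8]. *)
have [s [s2 [c' c'C c'cor]]] : exists s : R, s ^+ 2 = 1 /\
    exists2 c', c' \in C & alpha / 2 <= s * \sum_x pm (c' x) * mu x.
  have [h|h] := leP (alpha / 2) (\sum_x pm (sval c x) * mu x).
    by exists 1; split => //; exists (sval c); [exact: valP|rewrite mul1r].
  by exists (-1); split => //; exists cs => //; lra.
exists s, (fun os => \sum_(h | pred1 true h) Dec os h); split => //.
- exact: decoder_bms dDec.
- by move=> os; exact: (decoder_01 _ os dDec).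
apply: sqr_test => //.
have dDs := symm _ _ _ s2 mup p1.
have dD0 := null _ _ mup p1.
have F1 : 1 - beta <= pexp Q (biased p (fun x => s * mu x))
    (fun os => \sum_(h | pred1 true h) Dec os h).
  have [+ _] := H _ dDs; rewrite succ_probE// lee_fin; apply.
  apply/exists_inP; exists c' => //; rewrite loss_biased// sumZ; lra.
have F0 : pexp Q (biased p (fun=> 0))
    (fun os => \sum_(h | pred1 true h) Dec os h) <= beta.
  rewrite pexp_decoderC// lerBlDr -lerBlDl.
  have [_ +] := H _ dD0; rewrite succ_probE// lee_fin => h.
  apply: le_trans (h _) _.
    move=> f; rewrite loss_biased// big1 ?mulr0 ?subr0// => x _; exact: mulr0.
  by apply: pexp_decoder_sub => // -[].
lra.
Qed.

End LearningLowerBound.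

(** * Riesz products and the local randomizer *)

Section RieszProduct.
Context {R : realType}.

(** Independence of uniform signs, stated over a commutative ring so as to serve both real
    exponentials and complex Riesz products. *)
Lemma sum_prod_tuple (A : comNzRingType) k (F : 'I_k -> bool -> A) :
  \sum_(s : k.-tuple bool) \prod_(j < k) F j (tnth s j) =
  \prod_(j < k) (F j true + F j false).
Proof.
rewrite (reindex (fun f : {ffun 'I_k -> bool} => [tuple f j | j < k])) /=; last first.
  exists (fun s => [ffun j => tnth s j]).
    by move=> f _; apply/ffunP => j; rewrite ffunE tnth_mktuple.
  by move=> s _; apply: eq_from_tnth => j; rewrite tnth_mktuple ffunE.
under [RHS]eq_bigr do rewrite -big_bool.
rewrite bigA_distr_bigA /=; apply: eq_bigr => f _.
by apply: eq_bigr => j _; rewrite tnth_mktuple.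
Qed.

Variable k : nat.
Implicit Types (v l : 'I_k -> R) (s : k.-tuple bool).

Definition sgv s (j : 'I_k) : R := pm (tnth s j).

(* Its imaginary part has degree-one coefficients [v j], while its modulus
   [prod_j sqrt (1 + v_j^2)] stays below [exp (|v|^2 / 2)]. *)
Definition rprod v s : R[i] := \prod_(j < k) Complex 1 (v j * sgv s j).

Definition riesz v s : R := complex.Im (rprod v s) / 2.

Definition sqmod (z : R[i]) : R := complex.Re z ^+ 2 + complex.Im z ^+ 2.

Lemma sqmodM z1 z2 : sqmod (z1 * z2) = sqmod z1 * sqmod z2.
Proof. by case: z1 z2 => [a b] [c d]; rewrite /sqmod /=; ring. Qed.

(** The squared modulus is at most [exp 1 <= 4], so the imaginary part is at most 2; hence the
    division by 2 in [riesz]. *)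
Lemma riesz_le1 v s : \sum_j v j ^+ 2 <= 1 -> `|riesz v s| <= 1.
Proof.
move=> v1.
have h : sqmod (rprod v s) <= 4.
  have -> : sqmod (rprod v s) = \prod_j (1 + v j ^+ 2).
    rewrite /rprod (big_morph sqmod sqmodM (_ : sqmod 1 = 1)); last first.
      by rewrite /sqmod /= expr1n expr0n addr0.
    by apply: eq_bigr => j _; rewrite /sqmod /= expr1n exprMn pm_sqr mulr1.
  apply: (@le_trans _ _ (expR 1)); last first.
    by have := @expR_le_1D3 R 1; rewrite ler01 lexx => /(_ isT); lra.
  apply: (@le_trans _ _ (expR (\sum_j v j ^+ 2))); last by rewrite ler_expR.
  rewrite expR_sum; apply: ler_prod => j _; rewrite expR_ge1Dx andbT addr_ge0//.
  exact: sqr_ge0.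
have : complex.Im (rprod v s) ^+ 2 <= 4.
  by apply: le_trans h; rewrite /sqmod lerDr sqr_ge0.
by rewrite /riesz; move: (complex.Im _) => a; rewrite ler_norml => a4; apply/andP; split; nra.
Qed.

Lemma ImD (I : Type) (r : seq I) (F : I -> R[i]) :
  complex.Im (\sum_(i <- r) F i) = \sum_(i <- r) complex.Im (F i).
Proof. by elim/big_ind2: _ => // x1 x2 y1 y2 <- <-; case: x2 y2 => [? ?] []. Qed.

Lemma sum_sgv j : \sum_s sgv s j = 0.
Proof.
rewrite (eq_bigr (fun s => \prod_(i < k) (if i == j then pm (tnth s i) else 1 : R))).
  rewrite (sum_prod_tuple (fun i b => if i == j then pm b else 1)).
  by rewrite (bigD1 j)//= eqxx /pm subrr mul0r.
by move=> s _; rewrite -big_mkcond /= big_pred1_eq.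
Qed.

Lemma card_sgn : \sum_(s : k.-tuple bool) 1 = 2 ^+ k :> R.
Proof. by rewrite sumr_const card_tuple card_bool natrX. Qed.

Lemma two_complex m : (2 ^+ m : R[i]) = Complex (2 ^+ m) 0.
Proof.
elim: m => [//|m IH]; rewrite !exprS IH.
by rewrite -[2 : R[i]]/(Complex (1 + 1) (0 + 0)); apply/eqP; rewrite eq_complex /=; 
  apply/andP; split; apply/eqP; ring.
Qed.

Lemma sum_riesz v : \sum_s riesz v s = 0.
Proof.
rewrite -mulr_suml -ImD /rprod (sum_prod_tuple (fun j b => Complex 1 (v j * pm b))).
rewrite (eq_bigr (fun=> 2)) => [|j _].
  by rewrite prodr_const card_ord two_complex /= mul0r.
by apply/eqP; rewrite eq_complex /= /pm mulr1 mulrN1 subrr addr0 !eqxx.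
Qed.

(** Multiplying by the sign at [j] makes that coordinate contribute
    [(1 + i v_j) - (1 - i v_j) = 2 i v_j], while every other coordinate contributes 2. *)
Lemma sum_riesz_sgv v j : \sum_s riesz v s * sgv s j = 2 ^+ k * (v j / 2).
Proof.
have -> : \sum_s riesz v s * sgv s j =
    complex.Im (\sum_s rprod v s * Complex (sgv s j) 0) / 2.
  rewrite ImD mulr_suml; apply: eq_bigr => s _.
  by rewrite /riesz; case: (rprod v s) => a b /=; ring.
pose F i b : R[i] := Complex 1 (v i * pm b) * (if i == j then Complex (pm b) 0 else 1).
have -> : \sum_s rprod v s * Complex (sgv s j) 0 = \sum_s \prod_(i < k) F i (tnth s i).
  apply: eq_bigr => s _; rewrite /F big_split /= -/(rprod v s); congr (_ * _).
  by rewrite -big_mkcond /= big_pred1_eq.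
rewrite sum_prod_tuple (bigD1 j)//= (eq_bigr (fun=> 2)); last first.
  move=> i /negPf ij; rewrite /F ij; lazy iota; rewrite !mulr1.
  by apply/eqP; rewrite eq_complex /= /pm ?mulr1 mulrN1 subrr addr0 !eqxx.
rewrite prodr_const cardC1 card_ord two_complex /F eqxx /= /pm.
case: k j v {F} => [[]//|k' j v] /=; rewrite exprS; ring.
Qed.

End RieszProduct.

(** * The tilted sign distribution: privacy, mean and exponential moments *)

Section Randomizer.
Context {R : realType}.

(** An elementary form of the subgaussian bound for a sign. For [x > 1 / 2] one has [x <= 2 x^2];
    for smaller [x], the bounds [1 - x <= exp (- x)] and [1 + x <= exp x] give
    [(1 - x^2) cosh x <= 1]. *)
Lemma cosh_le (x : R) : expR x + expR (- x) <= 2 * expR (2 * x ^+ 2).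
Proof.
wlog x0 : x / 0 <= x.
  move=> h; have [/h//|/ltW x0] := leP 0 x.
  by have := h (- x); rewrite oppr_ge0 sqrrN opprK addrC; exact.
have [x2|x2] := leP x 2^-1; last first.
  have : expR x <= expR (2 * x ^+ 2) by rewrite ler_expR; nra.
  have : expR (- x) <= expR (2 * x ^+ 2) by rewrite ler_expR; nra.
  lra.
have e1 : (1 - x) * expR x <= 1.
  rewrite -[leRHS](expRxMexpNx_1 x) [leLHS]mulrC; apply: ler_wpM2l; first exact: expR_ge0.
  exact: expR_ge1Dx.
have e2 : (1 + x) * expR (- x) <= 1.
  rewrite -[leRHS](expRxMexpNx_1 x); apply: ler_wpM2r; first exact: expR_ge0.
  exact: expR_ge1Dx.
have s0 : 0 < 1 - x ^+ 2 by nra.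
have h : (1 - x ^+ 2) * (expR x + expR (- x)) <= 2 by nra.
have h2 : 1 <= (1 - x ^+ 2) * expR (2 * x ^+ 2).
  apply: (@le_trans _ _ ((1 - x ^+ 2) * (1 + 2 * x ^+ 2))); last first.
    by rewrite ler_pM2l// expR_ge1Dx.
  have xq : x ^+ 2 <= 4^-1 by nra.
  by have := sqr_ge0 x; nra.
by rewrite -(ler_pM2l s0); nra.
Qed.

Variable k : nat.
Implicit Types (v l : 'I_k -> R) (s : k.-tuple bool).

Definition sgsum l s : R := \sum_j l j * sgv s j.


Lemma sum_expR_sgsum l (t : R) :
  \sum_s expR (t * sgsum l s) <= 2 ^+ k * expR (2 * (t ^+ 2 * \sum_j l j ^+ 2)).
Proof.
have -> : \sum_s expR (t * sgsum l s) =
    \sum_(s : k.-tuple bool) \prod_(j < k) expR (t * l j * pm (tnth s j)).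
  apply: eq_bigr => s _; rewrite -expR_sum mulr_sumr; congr expR.
  by apply: eq_bigr => j _; rewrite mulrA.
rewrite (sum_prod_tuple (fun j b => expR (t * l j * pm b))).
have -> : 2 ^+ k * expR (2 * (t ^+ 2 * \sum_j l j ^+ 2)) =
    \prod_(j < k) (2 * expR (2 * (t * l j) ^+ 2)).
  rewrite big_split /= prodr_const card_ord -expR_sum; congr (_ * expR _).
  by rewrite !mulr_sumr; apply: eq_bigr => j _; rewrite exprMn.
apply: ler_prod => j _; rewrite addr_ge0 ?expR_ge0//= /pm mulr1 mulrN1.
exact: cosh_le.
Qed.

Definition rpmf (delta : R) (y : bool) v s : R :=
  (2 ^+ k)^-1 * (1 + delta * pm y * riesz v s).

Variables (delta : R) (v : 'I_k -> R).
Hypotheses (delta01 : 0 <= delta <= 1) (v1 : \sum_j v j ^+ 2 <= 1).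

Lemma rpmf_bounds y s :
  (2 ^+ k)^-1 * (1 - delta) <= rpmf delta y v s <= (2 ^+ k)^-1 * (1 + delta).
Proof.
have k0 : 0 < (2 ^+ k)^-1 :> R by rewrite invr_gt0 exprn_gt0.
case/andP: delta01 => d0 d1.
have := riesz_le1 s v1; rewrite ler_norml => /andP[r1 r2].
by rewrite !ler_pM2l//; case: y; rewrite /pm; apply/andP; split; nra.
Qed.

Lemma rpmf_ge0 y s : 0 <= rpmf delta y v s.
Proof.
have /andP[+ _] := rpmf_bounds y s; apply: le_trans.
by rewrite mulr_ge0 ?invr_ge0 ?exprn_ge0//; case/andP: delta01; lra.
Qed.

Lemma sum_rpmf y : \sum_s rpmf delta y v s = 1.
Proof.
rewrite -mulr_sumr big_split /= -mulr_sumr sum_riesz mulr0 addr0 card_sgn.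
by rewrite mulVf// expf_neq0.
Qed.

Lemma rpmf_ldp (eps : R) y (y' : bool) v' s : delta = eps / 4 -> 0 < eps <= 1 ->
  \sum_j v' j ^+ 2 <= 1 -> rpmf delta y v s <= expR eps * rpmf delta y' v' s.
Proof.
move=> dE /andP[e0 e1] v1'.
have /andP[_ h1] := rpmf_bounds y s; apply: (le_trans h1).
have k0 : 0 < (2 ^+ k)^-1 :> R by rewrite invr_gt0 exprn_gt0.
have h2 : (2 ^+ k)^-1 * (1 - delta) <= rpmf delta y' v' s.
  rewrite /rpmf ler_pM2l//; case/andP: delta01 => d0 d1.
  have := riesz_le1 s v1'; rewrite ler_norml => /andP[r1 r2].
  by case: y'; rewrite /pm; nra.
apply: (@le_trans _ _ (expR eps * ((2 ^+ k)^-1 * (1 - delta)))); last first.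
  by rewrite ler_pM2l// expR_gt0.
rewrite mulrCA ler_pM2l//.
(* With [delta = eps / 4], the density ratio [(1 + delta) / (1 - delta)] is at most [1 + eps]. *)
have := expR_ge1Dx eps; rewrite dE; nra.
Qed.

Lemma rpmf_mean y l : \sum_s rpmf delta y v s * sgsum l s =
  delta / 2 * pm y * \sum_j l j * v j.
Proof.
transitivity (\sum_j l j * \sum_s rpmf delta y v s * sgv s j).
  under eq_bigr do rewrite mulr_sumr.
  rewrite exchange_big /=; apply: eq_bigr => j _.
  by rewrite mulr_sumr; apply: eq_bigr => s _; rewrite mulrCA.
rewrite mulr_sumr; apply: eq_bigr => j _.
have -> : \sum_s rpmf delta y v s * sgv s j =
    (2 ^+ k)^-1 * (\sum_s sgv s j + delta * pm y * \sum_s riesz v s * sgv s j).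
  rewrite mulr_sumr -big_split mulr_sumr /=; apply: eq_bigr => s _.
  by rewrite /rpmf; ring.
rewrite sum_sgv sum_riesz_sgv; field.
by rewrite expf_neq0.
Qed.

(* [exp x <= 1 + x + (exp x + exp (-x) - 2)] reduces the exponential moment under the tilted law to
   that of the uniform law. *)
Lemma rpmf_mgf y l (t q : R) : \sum_j l j ^+ 2 <= q -> 2 * (t ^+ 2 * q) <= 1 ->
  \sum_s rpmf delta y v s * expR (t * sgsum l s) <=
  1 + t * (delta / 2 * pm y * \sum_j l j * v j) + 24 * (t ^+ 2 * q).
Proof.
move=> lq tq.
pose cs s := expR (t * sgsum l s) + expR (- t * sgsum l s) - 2.
have cs0 s : 0 <= cs s.
  have := expR_ge1Dx (t * sgsum l s); have := expR_ge1Dx (- t * sgsum l s).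
  by rewrite /cs mulNr; lra.
have q0 : 0 <= q by apply: le_trans lq; apply: sumr_ge0 => j _; exact: sqr_ge0.
have tq0 : 0 <= t ^+ 2 * q by rewrite mulr_ge0 ?sqr_ge0.
have k0 : 0 < 2 ^+ k :> R by rewrite exprn_gt0.
apply: (@le_trans _ _ (\sum_s (rpmf delta y v s * (1 + t * sgsum l s) +
    (2 ^+ k)^-1 * 2 * cs s))).
  apply: ler_sum => s _.
  have /andP[_ hb] := rpmf_bounds y s; have h0 := rpmf_ge0 y s.
  apply: (@le_trans _ _ (rpmf delta y v s * (1 + t * sgsum l s + cs s))).
    apply: ler_wpM2l => //; rewrite /cs.
    by have := expR_ge1Dx (- t * sgsum l s); rewrite mulNr; lra.
  rewrite [leLHS]mulrDr lerD2l; apply: ler_wpM2r => //; apply: (le_trans hb).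
  by rewrite ler_pM2l ?invr_gt0//; case/andP: delta01; lra.
rewrite big_split /=; apply: (@le_trans _ _ (1 + t * (delta / 2 * pm y *
   \sum_j l j * v j) + (2 ^+ k)^-1 * 2 * \sum_s cs s)).
  rewrite -mulr_sumr lerD2r -rpmf_mean -[X in X + _](sum_rpmf y) mulr_sumr -big_split /=.
  by rewrite le_eqVlt; apply/orP; left; apply/eqP; apply: eq_bigr => s _; ring.
rewrite lerD2l.
(* The 6 doubles to 12 over the two exponentials in [cs], and again to 24 because the density is at
   most twice uniform. *)
have E : expR (2 * (t ^+ 2 * \sum_j l j ^+ 2)) <= 1 + 6 * (t ^+ 2 * q).
  apply: (@le_trans _ _ (expR (2 * (t ^+ 2 * q)))).
    by rewrite ler_expR ler_wpM2l// ler_wpM2l// sqr_ge0.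
  apply: (le_trans (expR_le_1D3 _)); [|lra].
  by rewrite tq andbT mulr_ge0.
have S1 := sum_expR_sgsum l t; have S2 := sum_expR_sgsum l (- t).
rewrite sqrrN in S2.
have : \sum_s cs s <= 2 ^+ k * (12 * (t ^+ 2 * q)).
  rewrite /cs sumrB big_split /=.
  have -> : \sum_(s : k.-tuple bool) (2 : R) = 2 * 2 ^+ k.
    by rewrite -card_sgn mulr_sumr; apply: eq_bigr => s _; rewrite mulr1.
  move: S1 S2 E; set e := expR _ => S1 S2 E.
  have : 2 ^+ k * e <= 2 ^+ k * (1 + 6 * (t ^+ 2 * q)) by rewrite ler_pM2l.
  lra.
move=> h; rewrite -mulrA mulrC ler_pdivrMr//; lra.
Qed.

End Randomizer.

(** * Probability measures on a finite report space *)

Section Discrete.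
Context {R : realType}.

(** Singletons are finite intersections of coordinate preimages, and every set is a finite union of
    singletons; all decoders on sign vectors are therefore measurable. *)
Lemma tuple_discrete d (T : measurableType d) n :
  (forall B : set T, measurable B) -> finite_set [set: n.-tuple T] ->
  forall A : set (n.-tuple T), measurable A.
Proof.
move=> mT fin A.
rewrite (_ : A = \bigcup_(t in A) [set t]); last first.
  by apply/seteqP; split=> [x Ax|x [t At ->]//]; exists x.
apply: fin_bigcup_measurable => [|t _]; first exact: (sub_finite_set _ fin).
rewrite (_ : [set t] = \bigcap_(i in [set: 'I_n]) ((@tnth n T)^~ i @^-1` [set tnth t i])).
  apply: fin_bigcap_measurable => [|i _]; first exact: finite_finset.
  by rewrite -[X in measurable X]setTI; apply: measurable_tnth.
apply/seteqP; split => [_ -> //|u tu].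
by apply: eq_from_tnth => i; exact: tu.
Qed.

Variable k : nat.
Notation T := (k.-tuple bool).

Lemma boolseq_discrete (A : set T) : measurable A.
Proof. by apply: tuple_discrete => //; exact: finite_finset. Qed.

Lemma boolseq_tuple_discrete n (A : set (n.-tuple T)) : measurable A.
Proof. by apply: tuple_discrete; [exact: boolseq_discrete|exact: finite_finset]. Qed.

Lemma bmf_boolseq (f : T -> R) : bmf f.
Proof.
split; first by move=> _ Y _; exact: boolseq_discrete.
exists (\sum_s `|f s|) => x; rewrite (bigD1 x)//= lerDl sumr_ge0//.
Qed.

Lemma bms_boolseq n (F : seq T -> R) : bms n F.
Proof.
split; first by move=> _ Y _; exact: boolseq_tuple_discrete.
exists (\sum_(t : n.-tuple T) `|F t|) => x; rewrite (bigD1 x)//= lerDl sumr_ge0//.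
Qed.

Section Pmf.
Variable (rho : T -> R).
Hypotheses (rho0 : forall s, 0 <= rho s) (rho1 : \sum_s rho s = 1).

(** A finite sum of weighted Dirac masses. The enumeration provides the natural-number index that
    [msum] expects, and the default of [nth] is never reached. *)
Definition pmf_measure : set T -> \bar R :=
  msum (fun i => mscale (NngNum (rho0 (nth [tuple of nseq k false] (enum {: T}) i)))
                        (\d_(nth [tuple of nseq k false] (enum {: T}) i))) #|{: T}|.

HB.instance Definition _ := Measure.on pmf_measure.

Lemma pmf_measureE A : pmf_measure A = (\sum_s (rho s)%:E * \d_s A)%E.
Proof.
rewrite /pmf_measure /msum /mscale /=.
rewrite -(big_mkord xpredT (fun i => (rho (nth [tuple of nseq k false] (enum {: T}) i))%:E *
  \d_(nth [tuple of nseq k false] (enum {: T}) i) A)%E).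
by rewrite cardE -(big_nth _ xpredT (fun s => (rho s)%:E * \d_s A)%E) big_enum.
Qed.

Lemma pmf_measure_setT : pmf_measure setT = 1%E.
Proof.
rewrite pmf_measureE; under eq_bigr do rewrite diracT mule1.
by rewrite sumEFin rho1.
Qed.

HB.instance Definition _ := @Measure_isProbability.Build _ _ _ pmf_measure pmf_measure_setT.

Definition pmf_probability : probability T R := pmf_measure.

Lemma pmf_probability_set1 s : pmf_probability [set s] = (rho s)%:E.
Proof.
rewrite [LHS]pmf_measureE (bigD1 s)//= big1 ?adde0 => [|u us].
  by rewrite diracE mem_set// mule1.
by rewrite diracE memNset ?mule0//= => us'; rewrite us' eqxx in us.
Qed.

End Pmf.

Lemma bexp_boolseq (P : probability T R) (rho : T -> R) (g : T -> R) :
  (forall s, P [set s] = (rho s)%:E) -> \int[P]_s g s = \sum_s rho s * g s.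
Proof.
move=> Prho.
transitivity (\int[P]_s (\sum_u g u * \1_[set u] s)).
  apply: eq_Rintegral => s _; rewrite (bigD1 s)//= indicE mem_set// mulr1.
  rewrite big1 ?addr0// => u us; rewrite indicE memNset ?mulr0//= => us'.
  by rewrite us' eqxx in us.
rewrite bexp_sum; last by move=> u; exact: bmf_boolseq.
apply: eq_bigr => u _; rewrite bexpZ; last exact: bmf_boolseq.
rewrite mulrC; congr (_ * _).
rewrite /Rintegral integral_indic//; last exact: boolseq_discrete.
by rewrite setIT [X in fine X]Prho.
Qed.

End Discrete.

(** * Concentration of the aggregated reports *)

Section Concentration.
Context {R : realType} (k : nat).
Notation T := (k.-tuple bool).
Let o0 : T := [tuple of nseq k false].

Lemma pmf_probability_LDP (Z : Type) (eps : R) (rho : Z -> T -> R)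
    (rho0 : forall z s, 0 <= rho z s) (rho1 : forall z, \sum_s rho z s = 1) :
  (forall z z' s, rho z s <= expR eps * rho z' s) ->
  eps_LDP eps (fun z => pmf_probability (rho0 z) (rho1 z)).
Proof.
move=> rle z z' S mS; rewrite [leLHS]pmf_measureE [X in (_ * X)%E]pmf_measureE.
rewrite ge0_sume_distrr; last first.
  by move=> s _; rewrite mule_ge0// ?lee_fin.
apply: lee_sum => s _; rewrite muleA; apply: lee_wpmul2r => //.
by rewrite -EFinM lee_fin.
Qed.

Lemma pexp_prod (Z : finType) n (Q : 'I_n -> Z -> probability T R) (D : Z -> R)
    (f : 'I_n -> T -> R) :
  pexp Q D (fun os => \prod_(i < n) f i (nth o0 os i)) = \prod_(i < n) mexp (Q i) D (f i).
Proof.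
elim: n Q f => [|n IH] Q f; first by rewrite pexp0 !big_ord0.
rewrite pexpS; last exact: bms_boolseq.
rewrite big_ord_recl -IH /mexp mulr_suml; apply: eq_bigr => z _.
rewrite -mulrA; congr (_ * _).
rewrite mulrC -bexpZ; last exact: bmf_boolseq.
apply: eq_Rintegral => o _.
rewrite mulrC -pexpZ; last exact: bms_boolseq.
by congr pexp; apply/funext => os; rewrite big_ord_recl.
Qed.

Variables (Z : finType) (delta : R) (sgn : Z -> bool) (v : Z -> 'I_k -> R).
Hypotheses (delta01 : 0 <= delta <= 1) (v1 : forall z, \sum_j v z j ^+ 2 <= 1).

Definition riesz_randomizer (z : Z) : probability T R :=
  pmf_probability (rpmf_ge0 delta01 (v1 z) (sgn z)) (sum_rpmf delta (v z) (sgn z)).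

Lemma mexp_riesz (D : Z -> R) (g : T -> R) :
  mexp riesz_randomizer D g = \sum_z D z * \sum_s rpmf delta (sgn z) (v z) s * g s.
Proof.
apply: eq_bigr => z _; congr (_ * _).
by apply: bexp_boolseq => s; exact: pmf_probability_set1.
Qed.

(** The mean of [sgsum l] over one report when the datum has law [D]. *)
Definition rmean (D : Z -> R) (l : 'I_k -> R) : R :=
  \sum_z D z * (delta / 2 * pm (sgn z) * \sum_j l j * v z j).

(* Chernoff bound with exponent [t = eta / (48 q)]. *)
Lemma riesz_tail n (D : Z -> R) (l : 'I_k -> R) (q eta : R) : is_dist D ->
  \sum_j l j ^+ 2 <= q -> 0 < q -> 0 <= eta -> eta ^+ 2 <= q ->
  pexp (fun _ : 'I_n => riesz_randomizer) D
    (fun os => (n%:R * (rmean D l + eta) <= \sum_(i < n) sgsum l (nth o0 os i))%R%:R)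
  <= expR (- (n%:R * (eta ^+ 2 / (96 * q)))).
Proof.
move=> dD lq q0 eta0 etaq.
pose t := eta / (48 * q).
have t0 : 0 <= t by rewrite divr_ge0// mulr_ge0// ltW.
have tq : t ^+ 2 * q = eta ^+ 2 / (48 * 48 * q).
  by rewrite /t; field; rewrite gt_eqF.
have tq1 : 2 * (t ^+ 2 * q) <= 1.
  have c0 : 0 < 48 * 48 * q by apply: mulr_gt0 => //; apply: mulr_gt0; rewrite ltr0n.
  by rewrite tq mulrA ler_pdivrMr// mul1r; lra.
pose f (o : T) := expR (t * (sgsum l o - (rmean D l + eta))).
apply: (@le_trans _ _ (pexp (fun _ : 'I_n => riesz_randomizer) D
    (fun os => \prod_(i < n) f (nth o0 os i)))).
  apply: le_pexp => // [||os _]; [exact: bms_boolseq..|].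
  rewrite /f -expR_sum -mulr_sumr sumrB sumr_const card_ord.
  have [h|h] := leP (n%:R * (rmean D l + eta)) (\sum_(i < n) sgsum l (nth o0 os i)); last by rewrite mulr0n expR_ge0.
  apply: le_trans (expR_ge1Dx _); rewrite lerDl mulr_ge0// subr_ge0.
  by rewrite -mulr_natl.
rewrite (pexp_prod (fun=> riesz_randomizer) D (fun=> f)) prodr_const card_ord.
rewrite -mulrN mulrC expRM_natr; apply: lerXn2r; rewrite ?nnegrE ?expR_ge0//.
  by rewrite mexp_riesz; apply: sumr_ge0 => z _; rewrite mulr_ge0 ?dD.1// sumr_ge0// => s _;
    rewrite mulr_ge0 ?expR_ge0// rpmf_ge0.
rewrite mexp_riesz.
have -> : \sum_z D z * \sum_s rpmf delta (sgn z) (v z) s * f s =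
    expR (- (t * (rmean D l + eta))) *
    \sum_z D z * \sum_s rpmf delta (sgn z) (v z) s * expR (t * sgsum l s).
  rewrite mulr_sumr; apply: eq_bigr => z _; rewrite mulrCA; congr (_ * _).
  rewrite mulr_sumr; apply: eq_bigr => s _; rewrite mulrCA; congr (_ * _).
  by rewrite -expRD /f; congr expR; ring.
apply: (@le_trans _ _ (expR (- (t * (rmean D l + eta))) *
    expR (t * rmean D l + 24 * (t ^+ 2 * q)))).
  apply: ler_wpM2l; first exact: expR_ge0.
  apply: le_trans (expR_ge1Dx _).
  have -> : 1 + (t * rmean D l + 24 * (t ^+ 2 * q)) = \sum_z D z * (1 +
      t * (delta / 2 * pm (sgn z) * \sum_j l j * v z j) + 24 * (t ^+ 2 * q)).
    rewrite -[X in X + _]dD.2 -[24 * _]mul1r -[X in _ + (_ + X * _)]dD.2.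
    rewrite /rmean mulr_sumr mulr_suml -!big_split /=.
    by apply: eq_bigr => z _; ring.
  by apply: ler_sum => z _; apply: ler_wpM2l; [exact: dD.1|exact: rpmf_mgf].
(* The exponent [t eta - 24 t^2 q] attains its maximum [eta^2 / (96 q)] at the chosen [t]. *)
rewrite -expRD ler_expR tq /t le_eqVlt; apply/orP; left; apply/eqP.
by field; rewrite gt_eqF.
Qed.

Lemma rmeanN D l : rmean D (fun j => - l j) = - rmean D l.
Proof.
rewrite /rmean -sumrN; apply: eq_bigr => z _.
by under eq_bigr do rewrite mulNr; rewrite sumrN; ring.
Qed.

(** Union bound over the concepts and the two directions of deviation. Leaving [F] abstract lets the
    learner and the refuter share the estimate. *)
Lemma riesz_uniform_tail (I : finType) n (D : Z -> R) (l : I -> 'I_k -> R) (q eta : R)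
    (F : seq T -> R) : is_dist D ->
  (forall c, \sum_j l c j ^+ 2 <= q) -> 0 < q -> 0 <= eta -> eta ^+ 2 <= q ->
  (forall os, 0 <= F os) ->
  (forall os, (forall c, `|\sum_(i < n) sgsum (l c) (nth o0 os i) - n%:R * rmean D (l c)|
                         < n%:R * eta) -> 1 <= F os) ->
  1 - #|I|%:R * (2 * expR (- (n%:R * (eta ^+ 2 / (96 * q))))) <=
  pexp (fun _ : 'I_n => riesz_randomizer) D F.
Proof.
move=> dD lq q0 eta0 etaq F0 good.
set e := expR _; pose Q (_ : 'I_n) := riesz_randomizer.
pose up (l : 'I_k -> R) (os : seq T) : R :=
  (n%:R * (rmean D l + eta) <= \sum_(i < n) sgsum l (nth o0 os i))%R%:R.
pose bad c os := up (l c) os + up (fun j => - l c j) os.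
have pF : pexp Q D (fun os => 1 + - F os) = 1 - pexp Q D F.
  rewrite pexpD ?pexp_cst//; [|exact: bms_boolseq..]; congr (_ + _).
  rewrite -mulN1r -pexpZ; last exact: bms_boolseq.
  by congr pexp; apply/funext => os; rewrite mulN1r.
suff : 1 - pexp Q D F <= #|I|%:R * (2 * e) by lra.
rewrite -pF; apply: (@le_trans _ _ (pexp Q D (fun os => \sum_c bad c os))).
  apply: le_pexp => // [||os _]; [exact: bms_boolseq..|].
  have bad0 c : 0 <= bad c os by rewrite addr_ge0// ler0n.
  have [g|ng] := pselect (forall c, `|\sum_(i < n) sgsum (l c) (nth o0 os i)
      - n%:R * rmean D (l c)| < n%:R * eta).
    have : 0 <= \sum_c bad c os by exact: sumr_ge0.
    by have := good _ g; lra.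
  have [c /negP] : exists c, ~ (`|\sum_(i < n) sgsum (l c) (nth o0 os i)
      - n%:R * rmean D (l c)| < n%:R * eta) by exact/existsNP.
  rewrite -leNgt => hc; rewrite (bigD1 c)//=.
  have : 1 <= bad c os.
    rewrite /bad /up rmeanN.
    have -> : \sum_(i < n) sgsum (fun j => - l c j) (nth o0 os i) =
        - \sum_(i < n) sgsum (l c) (nth o0 os i).
      rewrite -sumrN; apply: eq_bigr => i _; rewrite /sgsum -sumrN.
      by apply: eq_bigr => j _; rewrite mulNr.
    move: hc; rewrite ler_normr => /orP[h|h].
      have -> : (n%:R * (rmean D (l c) + eta) <= \sum_(i < n) sgsum (l c) (nth o0 os i)).
        by rewrite mulrDr; lra.
      by rewrite lerDl ler0n.
    have -> : (n%:R * (- rmean D (l c) + eta) <= - \sum_(i < n) sgsum (l c) (nth o0 os i)).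
      by rewrite mulrDr mulrN; lra.
    by rewrite lerDr ler0n.
  have : 0 <= \sum_(i | i != c) bad i os by exact: sumr_ge0.
  have := F0 os; lra.
rewrite pexp_sum//; last by move=> c; exact: bms_boolseq.
rewrite mulr_natl -sumr_const; apply: ler_sum => c _.
rewrite pexpD; [|exact: bms_boolseq..].
rewrite mulr_natl mulr2n; apply: lerD; apply: riesz_tail => //.
by under eq_bigr do rewrite sqrrN.
Qed.

End Concentration.

(** * Upper bound *)

Section UpperBound.
Context {R : realType}.

Lemma card_sig_set (X : finType) (C : {set X}) : #|{: {c | c \in C}}| = #|C|.
Proof. by rewrite card_sig; apply: eq_card => x; rewrite !inE. Qed.

Definition corr (X : finType) (D : X * bool -> R) (h : X -> bool) : R :=
  \sum_z D z * (pm z.2 * pm (h z.1)).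

Lemma loss_corr (X : finType) (D : X * bool -> R) (h : X -> bool) :
  is_dist D -> loss D h = 2^-1 - corr D h / 2.
Proof.
move=> [_ D1]; rewrite /loss big_mkcond /corr mulr_suml.
rewrite -[X in _ = X - _]mul1r -[X in _ = X * _ - _]D1 mulr_suml -sumrB.
apply: eq_bigr => -[x y] _ /=; rewrite /pm.
by case: (h x); case: y => /=; field.
Qed.

(** Every entry of an approximant has modulus at least [1 - alpha >= 1 / 2], and the cost of a
    factorization bounds the entries. This lets the sample bound absorb rounding. *)
Lemma gamma2_approx_ge_half (X : finType) (C : {set {ffun X -> bool}}) (alpha : R) :
  0 < alpha <= 2^-1 -> (0 < #|C|)%N -> (exists x : X, True) ->
  2^-1 <= gamma2_approx (concept_matrix C) alpha.
Proof.
move=> /andP[a0 a1] /card_gt0P[c cC] [x _]; rewrite leNgt; apply/negP => G2.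
have : gamma2_approx (concept_matrix C) alpha <
    (gamma2_approx (concept_matrix C) alpha + 2^-1) / 2 by lra.
move=> /(gamma2_approx_balanced (ltW a0)) [Mt Mta /(balanced_entry (exist _ c cC) x)].
have := Mta (exist _ c cC) x.
have : `|concept_matrix C (exist _ c cC) x : R| = 1.
  by apply/eqP; rewrite -sqr_norm_eq1 /concept_matrix pm_sqr.
move: (concept_matrix _ _ _) (Mt _ _) => w m.
have := ler_normD (w - m) m; rewrite subrK distrC; lra.
Qed.

Lemma ler_expR_ln (a b : R) : 0 < b -> - ln b <= a -> expR (- a) <= b.
Proof. by move=> b0 h; rewrite -[leRHS]lnK ?posrE// ler_expR lerNl. Qed.

(** The error [2 alpha] splits into [alpha] for replacing the concept matrix by its approximant and
    [alpha] for sampling. *)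
Lemma correlation_protocol (X : finType) (C : {set {ffun X -> bool}}) (eps alpha beta : R) :
  0 < eps <= 1 -> 0 < alpha <= 2^-1 -> 0 < beta <= 2^-1 ->
  (0 < #|C|)%N -> (exists x : X, True) ->
  exists (n k : nat) (Q : 'I_n -> X * bool -> probability (k.-tuple bool) R)
     (est : {c | c \in C} -> seq (k.-tuple bool) -> R),
    [/\ n%:R <= (256 * 400) * (gamma2_approx (concept_matrix C) alpha ^+ 2 * ln (#|C|%:R / beta))
          / (eps ^+ 2 * alpha ^+ 2),
        forall i, eps_LDP eps (Q i) &
        forall D (F : seq (k.-tuple bool) -> R), is_dist D -> (forall os, 0 <= F os) ->
          (forall os, (forall c, `|est c os - corr D (sval c)| < 2 * alpha) -> 1 <= F os) ->
          1 - beta <= pexp Q D F].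
Proof.
move=> eps01 alpha01 beta01 Cn0 Xn0.
have /andP[eps0 eps1] := eps01; have /andP[a0 a1] := alpha01; have /andP[b0 b1] := beta01.
have G2 := gamma2_approx_ge_half alpha01 Cn0 Xn0.
set G := gamma2_approx _ _ in G2 *.
(* The factor 2 supplies the strict inequality needed to extract a factorization without assuming
   that the infimum is attained. *)
have [|Mt Mta [K [L [A [LA Lr Ar]]]]] := @gamma2_approx_balanced _ _ _ (concept_matrix C) alpha (2 * G) (ltW a0).
  by rewrite -/G; lra.
set r := 2 * G in Lr Ar.
have r1 : 1 <= r by rewrite /r; lra.
have r0 : 0 < r by lra.
pose q : R := Num.sqrt r.
have q0 : 0 < q by rewrite sqrtr_gt0.
have q2 : q ^+ 2 = r by rewrite sqr_sqrtr// ltW.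
pose delta := eps / 4.
have delta01 : 0 <= delta <= 1 by rewrite /delta; apply/andP; split; lra.
(* Dividing the columns by [sqrt r] puts each user's vector in the unit ball, as the Riesz product
   requires; the rows absorb the factor, with squared norms up to [r^2]. *)
pose v (z : X * bool) (j : 'I_#|K|) : R := q^-1 * A (enum_val j) z.1.
pose l (c : {c | c \in C}) (j : 'I_#|K|) : R := q * L c (enum_val j).
have v1 z : \sum_j v z j ^+ 2 <= 1.
  rewrite (sum_enum_val (fun j => (q^-1 * A j z.1) ^+ 2)).
  under eq_bigr do rewrite exprMn exprVn q2.
  by rewrite -mulr_sumr mulrC ler_pdivrMr// mul1r.
have lq c : \sum_j l c j ^+ 2 <= r ^+ 2.
  rewrite (sum_enum_val (fun j => (q * L c j) ^+ 2)).
  under eq_bigr do rewrite exprMn q2.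
  by rewrite -mulr_sumr expr2 ler_pM2l.
have lv c z : \sum_j l c j * v z j = Mt c z.1.
  rewrite (sum_enum_val (fun j => (q * L c j) * (q^-1 * A j z.1))) -LA.
  by apply: eq_bigr => j _; field; rewrite gt_eqF.
(* The mean report carries the correlation multiplied by [delta / 2 = eps / 8], so accuracy [alpha]
   in the correlation means accuracy [eta] in the reports. *)
pose eta := eps * alpha / 8.
have eta0 : 0 < eta by rewrite divr_gt0 ?mulr_gt0.
have etar : eta ^+ 2 <= r ^+ 2.
  by rewrite ler_pXn2r ?nnegrE ?ltW// /eta; nra.
pose N := #|{: {c | c \in C}}|.
have NE : N = #|C| by exact: card_sig_set.
have N1 : 1 <= N%:R :> R by rewrite ler1n NE.
(* [B] solves [2 N exp (- B eta^2 / (96 r^2)) = beta], so that the union bound fails with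
   probability at most [beta]. *)
pose B := 96 * r ^+ 2 / eta ^+ 2 * ln (2 * N%:R / beta).
pose n := (Num.truncn B).+1.
have lnb : ln (2^-1) <= - (2^-1) :> R.
  by have := @le_ln1Dx R (- 2^-1); rewrite (_ : 1 + - 2^-1 = 2^-1); [apply; lra|field].
have N0 : 0 < N%:R :> R by lra.
have Nb2 : 2 <= N%:R / beta by rewrite ler_pdivlMr//; lra.
have Nb0 : 0 < N%:R / beta by lra.
have ln2 : 2^-1 <= ln (N%:R / beta).
  have : ln 2 <= ln (N%:R / beta) by rewrite ler_ln ?posrE.
  by have := @lnV R 2; rewrite posrE ltr0n => /(_ isT); lra.
have ln2N : ln (2 * N%:R / beta) <= 2 * ln (N%:R / beta).
  rewrite -mulrA lnM ?posrE// (_ : 2 * ln _ = ln (N%:R / beta) + ln (N%:R / beta)); last by ring.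
  by rewrite lerD2r ler_ln ?posrE.
have ln2N0 : 0 <= ln (2 * N%:R / beta).
  rewrite ln_ge0// ler_pdivlMr//; lra.
have B0 : 0 <= B.
  apply: mulr_ge0 => //; apply: divr_ge0; last exact: sqr_ge0.
  by apply: mulr_ge0; [rewrite ler0n|exact: sqr_ge0].
have /andP[Bn1 Bn2] := truncn_itv B0.
exists n, #|K|, (fun _ => riesz_randomizer (fun z : X * bool => z.2) delta01 v1),
  (fun c os => (\sum_(i < n) sgsum (l c) (nth [tuple of nseq #|K| false] os i))
      / (n%:R * (delta / 2))).
have n0 : 0 < n%:R :> R by rewrite ltr0n.
split.
(* Here [256 * 96 = 96 * 4 * 64] comes from [r = 2 G] and [eta = eps alpha / 8]. Replacing
   [2 N / beta] by [N / beta] doubles the logarithm, and the slack up to 200 absorbs the [+ 1] of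
   rounding. *)
- have -> : (256 * 400) * (G ^+ 2 * ln (#|C|%:R / beta)) / (eps ^+ 2 * alpha ^+ 2) =
      (256 * 200) * G ^+ 2 / (eps ^+ 2 * alpha ^+ 2) * (2 * ln (N%:R / beta)).
    by rewrite NE; field; rewrite !gt_eqF.
  have BE : B = (256 * 96) * G ^+ 2 / (eps ^+ 2 * alpha ^+ 2) * ln (2 * N%:R / beta).
    by rewrite /B /eta /r; field; rewrite !gt_eqF.
  set P := G ^+ 2 / (eps ^+ 2 * alpha ^+ 2).
  have P1 : 1 <= P.
    rewrite /P ler_pdivlMr ?mulr_gt0 ?exprn_gt0// mul1r.
    apply: (@le_trans _ _ (1 * 2^-1 ^+ 2)).
      apply: ler_pM; rewrite ?sqr_ge0//; first by rewrite expr_le1// ltW.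
      by rewrite ler_pXn2r ?nnegrE// ltW.
    by rewrite mul1r ler_pXn2r ?nnegrE//; lra.
  have BE' : B = (256 * 96) * P * ln (2 * N%:R / beta) by rewrite BE /P mulrA.
  have -> : (256 * 200) * G ^+ 2 / (eps ^+ 2 * alpha ^+ 2) = (256 * 200) * P by rewrite /P mulrA.
  have h1 : P * ln (2 * N%:R / beta) <= P * (2 * ln (N%:R / beta)).
    by rewrite ler_pM2l// (lt_le_trans ltr01).
  have h2 : 1 <= P * (2 * ln (N%:R / beta)) by nra.
  have : n%:R <= B + 1 by rewrite /n -natr1 lerD2r.
  rewrite BE'; lra.
- move=> i; apply: pmf_probability_LDP => z z' s.
  exact: (rpmf_ldp delta01 (v1 z) _ _ _ _ eps01 (v1 z')).
move=> D F dD F0 good.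
apply: le_trans (@riesz_uniform_tail R _ _ _ _ _ delta01 v1 _ n D l (r ^+ 2) eta F dD lq _
   (ltW eta0) etar F0 _); last 2 first.
- by rewrite exprn_gt0.
- move=> os dev; apply: good => c; have := dev c.
  have -> : rmean delta (fun z : X * bool => z.2) v D (l c) =
      delta / 2 * \sum_z D z * (pm z.2 * Mt c z.1).
    by rewrite /rmean mulr_sumr; apply: eq_bigr => z _; rewrite lv; ring.
  set S := \sum_(i < n) _; set m := \sum_z _ => {}dev.
  have d0 : 0 < delta / 2 by rewrite /delta; lra.
  have nd0 : 0 < n%:R * (delta / 2) by rewrite mulr_gt0.
  have close : `|m - corr D (sval c)| <= alpha.
    rewrite /m /corr -sumrB; apply: le_trans (ler_norm_sum _ _ _) _.
    rewrite -[leRHS]mul1r -dD.2 mulr_suml; apply: ler_sum => z _.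
    rewrite -mulrBr -mulrBr normrM (ger0_norm (dD.1 z)); apply: ler_wpM2l; first exact: dD.1.
    rewrite normrM (_ : `|pm z.2| = 1) ?mul1r; first exact: Mta.
    by apply/eqP; rewrite -sqr_norm_eq1 pm_sqr.
  have dev' : `|S / (n%:R * (delta / 2)) - m| < alpha.
    rewrite -(ltr_pM2l nd0) -{1}(gtr0_norm nd0) -normrM.
    rewrite (_ : n%:R * (delta / 2) * alpha = n%:R * eta); last by rewrite /eta /delta; field.
    move: dev; congr (`|_| < _); field; rewrite !gt_eqF//.
    by rewrite /delta; lra.
  have := ler_normD (S / (n%:R * (delta / 2)) - m) (m - corr D (sval c)).
  by rewrite addrA subrK; lra.
rewrite lerD2l lerN2 -/N.
rewrite mulrA -ler_pdivlMl ?mulr_gt0//.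
apply: ler_expR_ln; first by rewrite mulr_gt0 ?invr_gt0 ?mulr_gt0.
rewrite -lnV ?posrE ?mulr_gt0 ?invr_gt0 ?mulr_gt0//.
rewrite (_ : ((N%:R * 2)^-1 * beta)^-1 = 2 * N%:R / beta); last by field; rewrite !gt_eqF.
apply: (@le_trans _ _ (B * (eta ^+ 2 / (96 * r ^+ 2)))); last first.
  apply: ler_wpM2r (ltW Bn2); apply: divr_ge0; first exact: sqr_ge0.
  by apply: mulr_ge0; [rewrite ler0n|exact: sqr_ge0].
rewrite le_eqVlt; apply/orP; left; apply/eqP.
by rewrite /B; field; rewrite (gt_eqF r0) (gt_eqF eta0).
Qed.

End UpperBound.

(** * Decoders for learning and refutation *)

Section LearningUpperBound.
Context {R : realType}.

Lemma corr_eq0 (X : finType) (D : X * bool -> R) : is_dist D ->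
  (forall h : {ffun X -> bool}, loss D h = 2^-1) -> forall h : {ffun X -> bool}, corr D h = 0.
Proof. by move=> dD h0 h; have := h0 h; rewrite loss_corr//; lra. Qed.

Lemma point_decoder d (O : measurableType d) (H : finType) n (f : seq O -> H) :
  (forall A : set (n.-tuple O), measurable A) ->
  is_decoder n (fun os h => (h == f os)%:R : R).
Proof.
move=> mT; split; first by move=> os h; rewrite ler0n.
split; last by move=> h _ Y _; exact: mT.
by move=> os; rewrite (bigD1 (f os))//= eqxx big1 ?addr0// => h /negPf ->.
Qed.

Lemma sum_point_decoder (H : finType) (h0 : H) (G : pred H) :
  G h0 -> \sum_(h | G h) (h == h0)%:R = 1 :> R.
Proof. by move=> G0; rewrite (bigD1 h0)//= eqxx big1 ?addr0// => h /andP[_ /negPf ->]. Qed.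

(** With no concepts any output succeeds, and an empty domain carries no distribution; no samples
    are needed. *)
Lemma trivial_learnable (X : finType) (C : {set {ffun X -> bool}}) (eps alpha beta : R) :
  0 <= beta -> #|C| = 0%N \/ (forall x : X, False) -> ldp_learnable C eps alpha beta 0.
Proof.
move=> b0 triv; pose h0 : {ffun X -> bool} := [ffun=> true].
have dDec := point_decoder (fun=> h0) (@boolseq_tuple_discrete 0 0).
exists _, (0.-tuple bool), (fun _ _ => \d_[tuple]), (fun _ h => (h == h0)%:R).
split; first by split=> // -[].
move=> D dD; rewrite succ_probE// lee_fin pexp0 sum_point_decoder; first by rewrite lerBlDr lerDl.
case: triv => [C0|Xe].
  by apply/forall_inP => c; rewrite (card0_eq C0).
have [_] := dD; rewrite big1 => [/eqP|[x b]]; first by rewrite eq_sym oner_eq0.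
by case: (Xe x).
Qed.

Lemma trivial_refutable (X : finType) (C : {set {ffun X -> bool}}) (eps alpha beta : R) :
  0 <= beta -> #|C| = 0%N \/ (forall x : X, False) -> ldp_refutable C eps alpha beta 0.
Proof.
move=> b0 triv.
have dDec := point_decoder (fun=> false) (@boolseq_tuple_discrete 0 0).
exists _, (0.-tuple bool), (fun _ _ => \d_[tuple]), (fun _ h => (h == false)%:R).
split; first by split=> // -[].
move=> D dD; split=> [/exists_inP[c cC _]|_].
  case: triv => [C0|Xe]; first by rewrite (card0_eq C0) in cC.
  have [_] := dD; rewrite big1 => [/eqP|[x b]]; first by rewrite eq_sym oner_eq0.
  by case: (Xe x).
by rewrite succ_probE// lee_fin pexp0 sum_point_decoder// lerBlDr lerDl.
Qed.

Theorem learning_upper_bound (X : finType) (C : {set {ffun X -> bool}}) (eps alpha beta : R) :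
  0 < eps <= 1 -> 0 < alpha <= 2^-1 -> 0 < beta <= 2^-1 ->
  exists n, [/\ n%:R <= 256 * 400 * (gamma2_approx (concept_matrix C) alpha ^+ 2 *
                  ln (#|C|%:R / beta)) / (eps ^+ 2 * alpha ^+ 2),
    ldp_learnable C eps (2 * alpha) beta n & ldp_refutable C eps (2 * alpha) beta n].
Proof.
move=> eps01 alpha01 beta01; have /andP[b0 b1] := beta01.
have [triv|ntriv] := pselect (#|C| = 0%N \/ (forall x : X, False)).
  exists 0%N; split; [|exact: trivial_learnable (ltW b0) triv|exact: trivial_refutable (ltW b0) triv].
  apply: divr_ge0; last by apply: mulr_ge0; exact: sqr_ge0.
  apply: mulr_ge0; first by apply: mulr_ge0; rewrite ler0n.
  apply: mulr_ge0; first exact: sqr_ge0.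
  (* For the empty class the claimed bound is zero, by the convention [ln 0 = 0]. *)
  have [C0|C0] := posnP #|C|; first by rewrite C0 mul0r ln0.
  rewrite ln_ge0// ler_pdivlMr// mul1r (le_trans b1)//.
  apply: (@le_trans _ _ 1); last by rewrite ler1n.
  by rewrite invf_le1// ler1n.
have C0 : (0 < #|C|)%N by rewrite lt0n; apply/eqP => C0; apply: ntriv; left.
have X0 : exists x : X, True.
  by apply/not_existsP => nX; apply: ntriv; right => x; exact: nX x I.
clear ntriv.
have [n [k [Q [est [nB ldp succ]]]]] := correlation_protocol eps01 alpha01 beta01 C0 X0.
exists n; split => //.
  have [c0 c0C] := card_gt0P C0.
  have /choice[best bestP] : forall os, exists c : {c | c \in C}, forall c', est c' os <= est c os.
    move=> os; have [c _ cmax] := @Order.TotalTheory.arg_maxP _ _ _ (exist _ c0 c0C)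
      xpredT (fun c => est c os) isT.
    by exists c => c'; exact: cmax.
  pose f os : {ffun X -> bool} := sval (best os).
  have dDec := point_decoder f (@boolseq_tuple_discrete k n).
  exists _, (k.-tuple bool), Q, (fun os h => (h == f os)%:R); split; first by split.
  move=> D dD; rewrite succ_probE// lee_fin; apply: succ => // [os|os close].
    by apply: sumr_ge0 => h _; rewrite ler0n.
  rewrite sum_point_decoder//; apply/forall_inP => c cC.
  (* Loss is affine in correlation with slope [-1/2], so two estimation errors of [2 alpha] cost at
     most [2 alpha] in loss. *)
  have := close (best os); have := close (exist _ c cC); have := bestP os (exist _ c cC).
  by rewrite !loss_corr// !ltr_norml /= -/(f os); lra.
(* The threshold [2 alpha] separates the cases: loss at most [1/2 - 2 alpha] means correlation at
   least [4 alpha], whereas all correlations vanish in the null case. *)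
pose f os := [exists c : {c | c \in C}, 2 * alpha <= est c os].
have dDec := point_decoder f (@boolseq_tuple_discrete k n).
exists _, (k.-tuple bool), Q, (fun os h => (h == f os)%:R); split; first by split.
move=> D dD; split=> [/exists_inP[c cC lossc]|null].
  rewrite succ_probE// lee_fin; apply: succ => // [os|os close].
    by apply: sumr_ge0 => h _; rewrite ler0n.
  rewrite sum_point_decoder//; apply/eqP/existsP; exists (exist _ c cC).
  have := close (exist _ c cC); move: lossc; rewrite loss_corr// ltr_norml /=; lra.
rewrite succ_probE// lee_fin; apply: succ => // [os|os close].
  by apply: sumr_ge0 => h _; rewrite ler0n.
rewrite sum_point_decoder//=; apply/eqP/negbTE/existsPn => c.
have := close c; rewrite (corr_eq0 dD null) subr0 ltr_norml -ltNge; lra.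
Qed.

End LearningUpperBound.

Local Close Scope classical_set_scope.

Theorem theorem1 :
  (* Upper bound *)
  (exists K : Rdefinitions.R, 0 < K /\
    forall (X : finType) (C : {set {ffun X -> bool}})
           (eps alpha beta : Rdefinitions.R),
      0 < eps -> eps <= 1 -> 0 < alpha <= 2^-1 -> 0 < beta <= 2^-1 ->
      let bound := K * (gamma2_approx (concept_matrix C) alpha ^+ 2
                        * ln (#|C|%:R / beta)) / (eps ^+ 2 * alpha ^+ 2) in
      (exists n : nat, n%:R <= bound /\ ldp_learnable C eps (2 * alpha) beta n) /\
      (exists n : nat, n%:R <= bound /\ ldp_refutable C eps (2 * alpha) beta n))
  /\
  (* Lower bound *)
  (forall c0 : Rdefinitions.R, 0 < c0 ->
    exists c1 c2 : Rdefinitions.R, 0 < c1 /\ 0 < c2 /\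
    forall (X : finType) (C : {set {ffun X -> bool}}) (eps alpha : Rdefinitions.R),
      0 < eps -> eps <= 1 -> 0 < alpha <= 2^-1 ->
      exists alpha' : Rdefinitions.R,
        c1 * alpha / ln (alpha^-1) <= alpha' /\
        forall beta : Rdefinitions.R, beta <= 2^-1 - c0 ->
        let bound := c2 * (Num.max 0 (gamma2_approx (concept_matrix C) alpha - 1)) ^+ 2
                         / (eps ^+ 2 * alpha ^+ 2) in
        (forall n : nat, ldp_learnable C eps alpha' beta n -> bound <= n%:R) /\
        (forall n : nat, ldp_refutable C eps alpha' beta n -> bound <= n%:R)).
Proof.
split.
  exists (256 * 400); split; first by apply: mulr_gt0; rewrite ltr0n.
  move=> X C eps alpha beta eps0 eps1 alpha01 beta01 /=.
  have eps01 : 0 < eps <= 1 by rewrite eps0.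
  have [n [nB lrn rft]] := learning_upper_bound C eps01 alpha01 beta01.
  by split; exists n.
(* For [alpha <= 1/2] the logarithm of [1 / alpha] is at least [ln 2], so [alpha / 8] dominates
   [c1 * alpha / ln (1 / alpha)] with [c1 = ln 2 / 8]. *)
move=> c0 c00; exists (ln 2 / 8), (c0 ^+ 2 / 16).
have ln2 : 0 < ln (2 : Rdefinitions.R) by rewrite ln_gt0// ltr1n.
split; first by rewrite divr_gt0.
split; first by rewrite divr_gt0// exprn_gt0.
move=> X C eps alpha eps0 eps1 /andP[alpha0 alpha1]; exists (alpha / 8).
have eps01 : 0 < eps <= 1 by rewrite eps0.
split.
  have lna : ln 2 <= ln alpha^-1.
    by rewrite ler_ln ?posrE ?invr_gt0// -[leLHS]invrK lef_pV2 ?posrE ?invr_gt0.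
  rewrite ler_pdivrMr ?(lt_le_trans ln2)// [leLHS]mulrC [leLHS]mulrA [leRHS]mulrAC.
  by rewrite ler_pM2r ?invr_gt0// ler_pM2l.
move=> beta beta1 /=.
by split=> n H; apply: learning_lower_bound eps01 alpha0 c00 beta1 _; [left|right].
Qed.
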